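(* Let $\alpha_0,\ldots,\alpha_4$ be complex parameters with $\alpha_0+\alpha_1+\alpha_2+\alpha_3+\alpha_4=1$, and consider the Hamiltonian system $$\begin{aligned} \frac{dq_1}{dt}&=2q_1^2+p_1+2t+4p_2+3p_4, & \frac{dp_1}{dt}&=-4q_1p_1+2q_2p_2-2\alpha_0,\\ \frac{dq_2}{dt}&=q_2^2-4p_2+4p_1-2q_1q_2, & \frac{dp_2}{dt}&=-2q_2p_2+2q_1p_2-\alpha_1,\\ \frac{dq_3}{dt}&=q_3^2-4p_3+4p_4-2q_3q_4, & \frac{dp_3}{dt}&=-2q_3p_3+2q_4p_3-\alpha_3,\\ \frac{dq_4}{dt}&=2q_4^2+p_4+2t+3p_1+4p_3, & \frac{dp_4}{dt}&=-4q_4p_4+2q_3p_3-2\alpha_4. \end{aligned}$$ This system admits the extended affine Weyl group symmetry of type $D_5^{(2)}$ as the group of its Bäcklund transformations, whose generators $s_0,s_1,s_2,s_3,s_4,\pi$ are given, with $( * ):=(q_1,p_1,q_2,p_2,q_3,p_3,q_4,p_4,t;\alpha_0,\alpha_1,\alpha_2,\alpha_3,\alpha_4)$ and $$D:=2p_1+4p_2+4p_3+2p_4+2q_1q_2-q_2q_3+2q_3q_4+4t,$$ by $$s_0:( * )\mapsto\left(q_1+\tfrac{4\alpha_0}{4p_1+q_2^2},p_1,q_2,p_2-\tfrac{2\alpha_0q_2}{4p_1+q_2^2},q_3,p_3,q_4,p_4,t;-\alpha_0,\alpha_1+2\alpha_0,\alpha_2,\alpha_3,\alpha_4\right),$$ $$s_1:(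 * )\mapsto\left(q_1,p_1,q_2+\tfrac{\alpha_1}{p_2},p_2,q_3,p_3,q_4,p_4,t;\alpha_0+\alpha_1,-\alpha_1,\alpha_2+\alpha_1,\alpha_3,\alpha_4\right),$$ $$\begin{aligned}s_2:( * )\mapsto\Big(&q_1+\tfrac{2\alpha_2}{D},\ p_1-\tfrac{2\alpha_2q_2}{D}-\tfrac{4\alpha_2^2}{D^2},\ q_2+\tfrac{4\alpha_2}{D},\ p_2-\tfrac{\alpha_2(2q_1-q_3)}{D},\\ &q_3+\tfrac{4\alpha_2}{D},\ p_3-\tfrac{\alpha_2(2q_4-q_2)}{D},\ q_4+\tfrac{2\alpha_2}{D},\ p_4-\tfrac{2\alpha_2q_3}{D}-\tfrac{4\alpha_2^2}{D^2},\ t;\\ &\alpha_0,\alpha_1+\alpha_2,-\alpha_2,\alpha_3+\alpha_2,\alpha_4\Big),\end{aligned}$$ $$s_3:( * )\mapsto\left(q_1,p_1,q_2,p_2,q_3+\tfrac{\alpha_3}{p_3},p_3,q_4,p_4,t;\alpha_0,\alpha_1,\alpha_2+\alpha_3,-\alpha_3,\alpha_4+\alpha_3\right),$$ $$s_4:( * )\mapsto\left(q_1,p_1,q_2,p_2,q_3,p_3-\tfrac{2\alpha_4q_3}{4p_4+q_3^2},q_4+\tfrac{4\alpha_4}{4p_4+q_3^2},p_4,t;\alpha_0,\alpha_1,\alpha_2,\alpha_3+2\alpha_4,-\alpha_4\right),$$ $$\pi:( * )\mapsto(q_4,p_4,q_3,p_3,q_2,p_2,q_1,p_1,t;\alpha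_4,\alpha_3,\alpha_2,\alpha_1,\alpha_0).$$
   Context: The $q_i,p_i$ are unknown complex functions of $t$. The system is Hamiltonian, $dq_i/dt=\partial H/\partial p_i$, $dp_i/dt=-\partial H/\partial q_i$ ($i=1,\ldots,4$), with $$H=G(q_1,p_1,q_2,p_2,t;\alpha_0,\alpha_1)+G(q_4,p_4,q_3,p_3,t;\alpha_4,\alpha_3)-\tfrac32p_1^2-\tfrac32p_4^2+3p_1p_4,$$ where $G(q_1,p_1,q_2,p_2,t;\alpha_0,\alpha_1)=2(q_1^2p_1+p_1^2+tp_1+\alpha_0q_1)+q_2^2p_2-2p_2^2+\alpha_1q_2+4p_1p_2-2q_1q_2p_2$. A Bäcklund transformation here is a birational transformation of the variables and parameters that leaves the form of the system invariant: it sends solutions of the system with parameters $(\alpha_0,\ldots,\alpha_4)$ to solutions of the same system with the transformed parameters. The notation $s:( * )\mapsto(\ldots)$ lists the images of the entries of $( * )$ in order, so each transformation is regarded as acting as an automorphism (by substitution) on rational functions of these variables. The affine Weyl group of type $D_5^{(2)}$ is the Coxeter group with generators $s_0,\ldots,s_4$ and defining relations $s_i^2=1$, $(s_0s_1)^4=(s_3s_4)^4=1$, $(s_1s_2)^3=(s_2s_3)^3=1$, $(s_is_j)^2=1$ for $|i-j|\ge2$. The extended affine Weyl group is its semidirect product with the group of order 2 generated by the diagram automorphism $\pi$, with $\pi^2=1$ and $\pi s_i\pi^{-1}=s_{4-i}$. ''Admits the extended affine Weyl group symmetry as the group of its Bäcklund transformations, with the given generators'' means that each listed transformation is a Bäcklund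 transformation of the system and that they realize the canonical generators of this extended group. *)

(* Defs.v *)
From HB Require Import structures.
From mathcomp Require Import all_boot all_order all_algebra fraction complex.
From mathcomp Require mpoly.
From mathcomp Require Import boolp classical_sets reals topology normedtype derive.

Set Implicit Arguments.
Unset Strict Implicit.
Unset Printing Implicit Defensive.

Import Order.TTheory GRing.Theory Num.Theory.
Import numFieldNormedType.Exports.

Local Open Scope ring_scope.

(* The group presented by generators s_i (i : I) and relations                *)
(* (s_i s_j)^(m i j) = 1: words in the generators modulo the least congruence *)
(* containing the relations. m i i = 1 encodes s_i^2 = 1 (so that no formal   *)
(* inverses are needed), and m i j = 0 would mean that there is no relation.  *)
Section Coxeter.
Local Open Scope quotient_scope.
Local Open Scope group_scope.

Variables (I : choiceType) (m : I -> I -> nat).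
Hypothesis m_diag : forall i, m i i = 1%N.

Inductive coxeter_rel : seq I -> seq I -> Prop :=
| CoxeterRefl u : coxeter_rel u u
| CoxeterSym u v : coxeter_rel u v -> coxeter_rel v u
| CoxeterTrans u v w :
    coxeter_rel u v -> coxeter_rel v w -> coxeter_rel u w
| CoxeterCat u u' v v' :
    coxeter_rel u u' -> coxeter_rel v v' -> coxeter_rel (u ++ v) (u' ++ v')
| CoxeterBraid i j : coxeter_rel (flatten (nseq (m i j) [:: i; j])) [::].

Definition coxeter_relb (u v : seq I) : bool := `[< coxeter_rel u v >].

Fact coxeter_relb_refl : reflexive coxeter_relb.
Proof. by move=> u; apply/asboolP/CoxeterRefl. Qed.

Fact coxeter_relb_sym : symmetric coxeter_relb.
Proof. by move=> u v; apply/asboolP/asboolP; apply: CoxeterSym. Qed.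

Fact coxeter_relb_trans : transitive coxeter_relb.
Proof.
move=> v u w /asboolP uv /asboolP vw.
by apply/asboolP; apply: CoxeterTrans uv vw.
Qed.

Canonical coxeter_equiv :=
  EquivRel coxeter_relb coxeter_relb_refl coxeter_relb_sym coxeter_relb_trans.

Lemma coxeter_rel_rev_cat u : coxeter_rel (rev u ++ u) [::].
Proof.
elim: u => [|i u IHu]; first exact: CoxeterRefl.
rewrite rev_cons -cats1 -catA; apply: CoxeterTrans IHu.
apply: CoxeterCat (CoxeterRefl _) _; rewrite -[i :: u]/([:: i] ++ u) catA.
rewrite -[X in coxeter_rel _ X]/([::] ++ u).
by apply: CoxeterCat (CoxeterRefl _); move: (CoxeterBraid i i); rewrite m_diag.
Qed.

Lemma coxeter_rel_rev u v : coxeter_rel u v -> coxeter_rel (rev u) (rev v).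
Proof.
move=> uv; apply: (@CoxeterTrans _ (rev u ++ (v ++ rev v))).
  rewrite -{1}[rev u]cats0; apply: CoxeterCat (CoxeterRefl _) _.
  by apply: CoxeterSym; have := coxeter_rel_rev_cat (rev v); rewrite revK.
rewrite catA -{2}[rev v]cat0s; apply: CoxeterCat (CoxeterRefl _).
apply: CoxeterTrans (coxeter_rel_rev_cat u).
exact: CoxeterCat (CoxeterRefl _) (CoxeterSym uv).
Qed.

End Coxeter.

(* Affine type D_5^(2): the diagram is s_0 = s_1 - s_2 - s_3 = s_4, with      *)
(* double bonds at both ends.                                                 *)
Definition D52_mx (i j : 'I_5) : nat :=
  nth 0%N (nth [::] [:: [:: 1; 4; 2; 2; 2];
                        [:: 4; 1; 3; 2; 2];
                        [:: 2; 3; 1; 3; 2];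
                        [:: 2; 2; 3; 1; 4];
                        [:: 2; 2; 2; 4; 1]]%N i) j.

Fact D52_mx_diag i : D52_mx i i = 1%N.
Proof. by case: i => [] [|[|[|[|[|]]]]]. Qed.

Fact D52_mx_rev i j : D52_mx (rev_ord i) (rev_ord j) = D52_mx i j.
Proof. by case: i j => [] [|[|[|[|[|]]]]] // ? [] [|[|[|[|[|]]]]]. Qed.

Section WeylD52.
Local Open Scope quotient_scope.
Local Open Scope group_scope.

Notation rel52 := (coxeter_rel D52_mx).

Definition weylD52 := {eq_quot (coxeter_equiv D52_mx)}.

HB.instance Definition _ : EqQuotient _ (coxeter_equiv D52_mx) weylD52 :=
  EqQuotient.on weylD52.
HB.instance Definition _ := Choice.on weylD52.

Definition weyl_word (u : seq 'I_5) : weylD52 := \pi_weylD52 u.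

Lemma weyl_wordP u v : weyl_word u = weyl_word v <-> rel52 u v.
Proof.
split=> [/eqP|uv]; rewrite /weyl_word; first by rewrite eqmodE => /asboolP.
by apply/eqP; rewrite eqmodE; apply/asboolP.
Qed.

Lemma weyl_wordK g : weyl_word (repr g) = g.
Proof. exact: reprK. Qed.

Lemma weyl_word_repr u : rel52 (repr (weyl_word u)) u.
Proof. by apply/weyl_wordP; rewrite weyl_wordK. Qed.

Definition weylD52_mul (g h : weylD52) : weylD52 :=
  weyl_word (repr g ++ repr h).
Definition weylD52_inv (g : weylD52) : weylD52 := weyl_word (rev (repr g)).
(* the automorphism s_i |-> s_(4-i)                                           *)
Definition weylD52_diag (g : weylD52) : weylD52 :=
  weyl_word (map (@rev_ord 5) (repr g)).

Lemma weylD52_mul_pi u v :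
  weylD52_mul (weyl_word u) (weyl_word v) = weyl_word (u ++ v).
Proof. by apply/weyl_wordP; apply: CoxeterCat; apply: weyl_word_repr. Qed.

Lemma weylD52_inv_pi u : weylD52_inv (weyl_word u) = weyl_word (rev u).
Proof.
by apply/weyl_wordP/coxeter_rel_rev/weyl_word_repr; apply: D52_mx_diag.
Qed.

Lemma coxeter_rel_map_rev_ord u v :
  rel52 u v -> rel52 (map (@rev_ord 5) u) (map (@rev_ord 5) v).
Proof.
elim=> {u v} [u|u v _|u v w _ uv _|u u' v v' _ uu' _ vv'|i j].
- exact: CoxeterRefl.
- exact: CoxeterSym.
- exact: CoxeterTrans.
- by rewrite !map_cat; apply: CoxeterCat.
- by rewrite map_flatten map_nseq -(D52_mx_rev i j); apply: CoxeterBraid.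
Qed.

Lemma weylD52_diag_pi u :
  weylD52_diag (weyl_word u) = weyl_word (map (@rev_ord 5) u).
Proof. by apply/weyl_wordP/coxeter_rel_map_rev_ord/weyl_word_repr. Qed.

Fact weylD52_mulA : associative weylD52_mul.
Proof.
move=> g h k; rewrite -[g]weyl_wordK -[h]weyl_wordK -[k]weyl_wordK.
by rewrite !weylD52_mul_pi catA.
Qed.

Fact weylD52_mul1 : left_id (weyl_word [::]) weylD52_mul.
Proof. by move=> g; rewrite -[g]weyl_wordK weylD52_mul_pi. Qed.

Fact weylD52_mulr1 : right_id (weyl_word [::]) weylD52_mul.
Proof. by move=> g; rewrite -[g]weyl_wordK weylD52_mul_pi cats0. Qed.

Fact weylD52_mulV : left_inverse (weyl_word [::]) weylD52_inv weylD52_mul.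
Proof.
move=> g; rewrite -[g]weyl_wordK weylD52_inv_pi weylD52_mul_pi.
exact/weyl_wordP/coxeter_rel_rev_cat/D52_mx_diag.
Qed.

Fact weylD52_mulrV : right_inverse (weyl_word [::]) weylD52_inv weylD52_mul.
Proof.
move=> g; rewrite -[g]weyl_wordK weylD52_inv_pi weylD52_mul_pi -{1}[repr g]revK.
exact/weyl_wordP/coxeter_rel_rev_cat/D52_mx_diag.
Qed.

HB.instance Definition _ := isGroup.Build weylD52
  weylD52_mulA weylD52_mul1 weylD52_mulr1 weylD52_mulV weylD52_mulrV.

Fact weylD52_diagM : {morph weylD52_diag : g h / g * h}.
Proof.
move=> g h; rewrite -[g]weyl_wordK -[h]weyl_wordK.
rewrite -[RHS]/(weylD52_mul _ _) -[X in weylD52_diag X]/(weylD52_mul _ _).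
by rewrite weylD52_mul_pi !weylD52_diag_pi weylD52_mul_pi map_cat.
Qed.

Fact weylD52_diagK : involutive weylD52_diag.
Proof.
move=> g; rewrite -[g]weyl_wordK !weylD52_diag_pi -map_comp map_id_in // => i _.
exact: rev_ordK.
Qed.

(* The semidirect product of weylD52 with the group of order 2 generated by   *)
(* the diagram automorphism: (g, b) stands for g * pi^b.                      *)
Definition ext_weylD52 : Type := weylD52 * bool.

HB.instance Definition _ := Choice.on ext_weylD52.

Definition twist (b : bool) (g : weylD52) := if b then weylD52_diag g else g.

Definition ext_weylD52_one : ext_weylD52 := (1, false).
Definition ext_weylD52_mul (x y : ext_weylD52) : ext_weylD52 :=
  (x.1 * twist x.2 y.1, x.2 (+) y.2).
Definition ext_weylD52_inv (x : ext_weylD52) : ext_weylD52 :=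
  (twist x.2 x.1^-1, x.2).

Lemma twistM b : {morph twist b : g h / g * h}.
Proof. by case: b => // g h; apply: weylD52_diagM. Qed.

Lemma twistD a b g : twist a (twist b g) = twist (a (+) b) g.
Proof. by case: a b => [] [] //=; rewrite weylD52_diagK. Qed.

Lemma twist1 b : twist b 1 = 1.
Proof. by apply: (mulgI (twist b 1)); rewrite -twistM !mulg1. Qed.

Fact ext_weylD52_mulA : associative ext_weylD52_mul.
Proof.
move=> [g a] [h b] [k c].
by rewrite /ext_weylD52_mul /= twistM twistD mulgA addbA.
Qed.

Fact ext_weylD52_mul1 : left_id ext_weylD52_one ext_weylD52_mul.
Proof. by move=> [g a]; rewrite /ext_weylD52_mul /= mul1g. Qed.

Fact ext_weylD52_mulr1 : right_id ext_weylD52_one ext_weylD52_mul.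
Proof. by move=> [g a]; rewrite /ext_weylD52_mul /= twist1 mulg1 addbF. Qed.

Fact ext_weylD52_mulV :
  left_inverse ext_weylD52_one ext_weylD52_inv ext_weylD52_mul.
Proof.
by move=> [g a]; rewrite /ext_weylD52_mul /= -twistM mulVg twist1 addbb.
Qed.

Fact ext_weylD52_mulrV :
  right_inverse ext_weylD52_one ext_weylD52_inv ext_weylD52_mul.
Proof.
by move=> [g a]; rewrite /ext_weylD52_mul /= twistD addbb mulgV.
Qed.

HB.instance Definition _ := isGroup.Build ext_weylD52 ext_weylD52_mulA
  ext_weylD52_mul1 ext_weylD52_mulr1 ext_weylD52_mulV ext_weylD52_mulrV.

Definition weyl_s (k : nat) : ext_weylD52 := (weyl_word [:: inord k], false).
Definition weyl_pi : ext_weylD52 := (1, true).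

End WeylD52.

(* R[i] seen as a numFieldType, whose normed topology is the usual one.      *)
Definition Cx (R : realType) : numFieldType := R[i].

Section System.
(* The notations of mpoly clash with those of topology.                       *)
Import -(notations) mpoly.

Variable R : realType.
Local Notation C := (Cx R).

(* The derivatives are complex derivatives: scalars range over C.             *)
Definition is_solution (U : set C) (a0 a1 a2 a3 a4 : C)
    (q1 p1 q2 p2 q3 p3 q4 p4 : C -> C) : Prop :=
  forall t : C, U t ->
  [/\ is_derive t (1 : C) q1
        (2 * q1 t ^+ 2 + p1 t + 2 * t + 4 * p2 t + 3 * p4 t)
    & is_derive t (1 : C) p1
        (- (4 * q1 t * p1 t) + 2 * q2 t * p2 t - 2 * a0)] /\
  [/\ is_derive t (1 : C) q2
        (q2 t ^+ 2 - 4 * p2 t + 4 * p1 t - 2 * q1 t * q2 t)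
    & is_derive t (1 : C) p2
        (- (2 * q2 t * p2 t) + 2 * q1 t * p2 t - a1)] /\
  [/\ is_derive t (1 : C) q3
        (q3 t ^+ 2 - 4 * p3 t + 4 * p4 t - 2 * q3 t * q4 t)
    & is_derive t (1 : C) p3
        (- (2 * q3 t * p3 t) + 2 * q4 t * p3 t - a3)] /\
  [/\ is_derive t (1 : C) q4
        (2 * q4 t ^+ 2 + p4 t + 2 * t + 3 * p1 t + 4 * p3 t)
    & is_derive t (1 : C) p4
        (- (4 * q4 t * p4 t) + 2 * q3 t * p3 t - 2 * a4)].

(* The functions (q_1, p_1, ..., q_4, p_4, t; alpha_1, ..., alpha_4) on U,   *)
(* for some parameters of sum 1 and some solution on U; alpha_0 is left out,  *)
(* being 1 - alpha_1 - ... - alpha_4.                                         *)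
Definition solution_curve (U : set C) (x : C -> 'I_13 -> C) : Prop :=
  exists a0 a1 a2 a3 a4 : C, a0 + a1 + a2 + a3 + a4 = 1 /\
  exists q1 p1 q2 p2 q3 p3 q4 p4 : C -> C,
    is_solution U a0 a1 a2 a3 a4 q1 p1 q2 p2 q3 p3 q4 p4 /\
    forall t : C, U t -> forall k : 'I_13,
      x t k = nth 0 [:: q1 t; p1 t; q2 t; p2 t; q3 t; p3 t; q4 t; p4 t; t;
                        a1; a2; a3; a4] k.

(* The rational functions on the hyperplane alpha_0 + ... + alpha_4 = 1, the  *)
(* coordinates being (q_1, p_1, ..., q_4, p_4, t; alpha_1, ..., alpha_4).     *)
Definition RatFun : fieldType := {fraction (mpoly 13 C)}.

Definition cst (c : C) : RatFun := tofrac (mpolyC 13 c).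
Definition coord (k : 'I_13) : RatFun :=
  tofrac (mpolyX C (mnm1 k)).

Definition has_value (f : RatFun) (v : 'I_13 -> C) (c : C) : Prop :=
  exists n d : mpoly 13 C,
    [/\ f = tofrac n / tofrac d, meval v d != 0
      & c = meval v n / meval v d].

(* An endomorphism s of RatFun moves a point v to the point with coordinates  *)
(* (s (coord k))(v). It is a Baecklund transformation if, on any open set     *)
(* where the image of a solution is defined, that image is a solution; the    *)
(* parameters of the latter are the transformed ones, as solution_curve       *)
(* records them among the coordinates.                                        *)
Definition backlund (s : RatFun -> RatFun) : Prop :=
  forall (U : set C) (x y : C -> 'I_13 -> C), open U ->
    solution_curve U x ->
    (forall t : C, U t -> forall k : 'I_13,
       has_value (s (coord k)) (x t) (y t k)) ->
    solution_curve U y.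

Let X k : RatFun := coord (inord k).
Let q1 := X 0%N. Let p1 := X 1%N. Let q2 := X 2%N. Let p2 := X 3%N.
Let q3 := X 4%N. Let p3 := X 5%N. Let q4 := X 6%N. Let p4 := X 7%N.
Let t := X 8%N.
Let a1 := X 9%N. Let a2 := X 10%N. Let a3 := X 11%N. Let a4 := X 12%N.
Let a0 := 1 - a1 - a2 - a3 - a4.
Let D := 2 * p1 + 4 * p2 + 4 * p3 + 2 * p4
         + 2 * q1 * q2 - q2 * q3 + 2 * q3 * q4 + 4 * t.

Definition star : seq RatFun :=
  [:: q1; p1; q2; p2; q3; p3; q4; p4; t; a0; a1; a2; a3; a4].

Definition s0_star : seq RatFun :=
  [:: q1 + 4 * a0 / (4 * p1 + q2 ^+ 2); p1;
      q2; p2 - 2 * a0 * q2 / (4 * p1 + q2 ^+ 2);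
      q3; p3; q4; p4; t;
      - a0; a1 + 2 * a0; a2; a3; a4].

Definition s1_star : seq RatFun :=
  [:: q1; p1; q2 + a1 / p2; p2; q3; p3; q4; p4; t;
      a0 + a1; - a1; a2 + a1; a3; a4].

Definition s2_star : seq RatFun :=
  [:: q1 + 2 * a2 / D; p1 - 2 * a2 * q2 / D - 4 * a2 ^+ 2 / D ^+ 2;
      q2 + 4 * a2 / D; p2 - a2 * (2 * q1 - q3) / D;
      q3 + 4 * a2 / D; p3 - a2 * (2 * q4 - q2) / D;
      q4 + 2 * a2 / D; p4 - 2 * a2 * q3 / D - 4 * a2 ^+ 2 / D ^+ 2; t;
      a0; a1 + a2; - a2; a3 + a2; a4].

Definition s3_star : seq RatFun :=
  [:: q1; p1; q2; p2; q3 + a3 / p3; p3; q4; p4; t;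
      a0; a1; a2 + a3; - a3; a4 + a3].

Definition s4_star : seq RatFun :=
  [:: q1; p1; q2; p2;
      q3; p3 - 2 * a4 * q3 / (4 * p4 + q3 ^+ 2);
      q4 + 4 * a4 / (4 * p4 + q3 ^+ 2); p4; t;
      a0; a1; a2; a3 + 2 * a4; - a4].

Definition pi_star : seq RatFun :=
  [:: q4; p4; q3; p3; q2; p2; q1; p1; t; a4; a3; a2; a1; a0].

End System.

(* Main.v *)
From HB Require Import structures.
From mathcomp Require Import all_boot all_order all_algebra fraction complex.
From mathcomp Require mpoly.
From mathcomp Require Import ring.
From mathcomp Require Import generic_quotient boolp classical_sets reals.
From mathcomp Require Import topology normedtype derive.
Require Import Defs.

(** Call a point the list of values of (q_1, p_1, ..., t; alpha_0, ...,
    alpha_4) in some field; [star] is the generic point, whose entries are the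
    coordinate functions.  Each generator is at once a rational map E of points
    over any field, and the substitution automorphism s of the field of rational
    functions with s(star) = E(star).  As s is a field morphism it commutes with
    every such map, so s s' (star) = E'(E(star)): an identity between words in
    the automorphisms is an identity between points, in any field.

    Existence of the automorphisms.  The substitution p |-> p(E(star)) is
    injective on polynomials, because E is an involution: evaluating p(E(star))
    at the point E(star) gives p(E(E(star))) = p back ([subst_mpoly_inj]), so it
    extends to fractions.

    Coxeter relations.  Each s_i is governed by one polynomial f_i, the
    denominator of its formulas: 4 p_1 + q_2^2 for s_0, p_2 for s_1, D for s_2.
    Once the successive images of the f_i are factored, the relations are
    identities in a field ([s0s1_braid], [s1s2_braid]).  The generators s_3 and
    s_4 are the conjugates of s_1 and s_0 by pi.

    Baecklund property.  Let delta be the derivation of the field of rational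
    functions given by the differential system.  Each generator s commutes with
    delta, by a computation on the coordinates, hence so does each word.  If the
    image of a solution x under a word s is defined near a time t, then
    s(coord k) = n/d there with d(x(t)) nonzero, and the chain rule gives
    y_k' = (delta s coord_k)(x) = (s delta coord_k)(x) = (delta coord_k)(y).
    Arguing with the whole word at once matters: the images of x under the
    partial words need not exist, for instance when p_2 vanishes identically
    along x.  The parameters of the image are integral combinations of those of
    x, hence constant on all of the open set, connected or not.

    Faithfulness.  The automorphisms act on the span of alpha_0, ..., alpha_4 by
    the geometric representation of the Coxeter group, the alpha_i being the
    simple roots.  By the classical argument of Tits ([reduced_pos]) a nontrivial
    element sends a simple root to a negative one.  A root is positive when it
    takes a positive value at one point where all simple roots are positive, so
    no coefficients have to be handled.  As pi only permutes the simple roots,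
    the same criterion covers the extended group. *)

Set Implicit Arguments.
Unset Strict Implicit.
Unset Printing Implicit Defensive.

Import Order.TTheory GRing.Theory Num.Theory.
Import numFieldNormedType.Exports.
Import -(notations) mpoly.

Local Open Scope ring_scope.

(** * A criterion for an action of a Coxeter group to be faithful *)

Section CoxeterFaithful.
Variables (I : choiceType) (m : I -> I -> nat).
Hypothesis m_diag : forall i, m i i = 1%N.
Hypothesis m_gt0 : forall i j, (0 < m i j)%N.
Local Notation rel := (coxeter_rel m).

(** The words t, st, tst, stst, ...: they are made to end in [t] because they
    are applied to the root of [s]. *)
Fixpoint alt_word k (s t : I) : seq I :=
  if k is k'.+1 then rcons (alt_word k' t s) t else [::].

Lemma size_alt_word k s t : size (alt_word k s t) = k.
Proof. by elim: k s t => //= k IHk s t; rewrite size_rcons IHk. Qed.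

Lemma alt_word_suffix j k s t :
  exists z, alt_word (j + k) s t = z ++ alt_word k s t.
Proof.
elim: k s t => [|k IHk] s t.
  by exists (alt_word j s t); rewrite addn0 cats0.
by rewrite addnS /=; have [z ->] := IHk t s; exists z; rewrite rcons_cat.
Qed.

Lemma braid_word_alt k s t :
  flatten (nseq k [:: s; t]) = rev (alt_word k t s) ++ alt_word k s t.
Proof.
elim: k s t => // k IHk s t.
have shift r a b : a :: flatten (nseq r [:: b; a]) =
                   rcons (flatten (nseq r [:: a; b])) a.
  by elim: r => //= r ->.
by rewrite /= shift IHk rev_rcons rcons_cat.
Qed.

Lemma cox_catl z u v : rel u v -> rel (z ++ u) (z ++ v).
Proof. exact/CoxeterCat/CoxeterRefl. Qed.

Lemma cox_catr z u v : rel u v -> rel (u ++ z) (v ++ z).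
Proof. by move=> uv; apply: CoxeterCat uv (CoxeterRefl _ _). Qed.

Lemma cox_sq u i v : rel (u ++ i :: i :: v) (u ++ v).
Proof.
apply: cox_catl; have /= := CoxeterBraid m i i; rewrite m_diag => ii.
exact: (cox_catr v ii).
Qed.

Lemma cox_alt s t : rel (alt_word (m s t) s t) (alt_word (m s t) t s).
Proof.
set k := m s t; have := cox_catl (alt_word k t s) (CoxeterBraid m s t).
rewrite -/k braid_word_alt catA cats0; apply: CoxeterTrans.
rewrite -{1}[alt_word k s t]cat0s; apply/cox_catr/CoxeterSym.
by have := coxeter_rel_rev_cat m_diag (rev (alt_word k t s)); rewrite revK.
Qed.

Definition reduced u := forall v, rel u v -> (size u <= size v)%N.

Lemma reduced_exists u : exists2 v, rel u v & reduced v.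
Proof.
have [n] := ubnP (size u); elim: n u => // n IHn u ltun.
have [|/existsNP[v /not_implyP[uv /negP]]] := pselect (reduced u).
  by exists u => //; apply: CoxeterRefl.
rewrite -ltnNge => ltvu.
have [|w vw redw] := IHn v; first exact: leq_trans ltvu _.
by exists w => //; apply: CoxeterTrans vw.
Qed.

Lemma square_free_alt_word k (x : seq I) s t : size x = k.+1 ->
  (forall i u v, x != u ++ i :: i :: v) ->
  {subset x <= [:: s; t]} -> last t x = t -> x = alt_word k.+1 s t.
Proof.
elim: k x s t => [|k IHk] x s t; case/lastP: x => // x a;
  rewrite size_rcons => -[sx] nosq sub; rewrite last_rcons => at_.
  by rewrite at_; case: x sx {nosq sub}.
rewrite at_ in nosq sub *; congr rcons.
case/lastP: x sx nosq sub => // x b sx nosq sub.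
have : b \in [:: s; t].
  by apply: sub; rewrite mem_rcons inE mem_rcons inE eqxx orbT.
rewrite !inE; case/orP=> /eqP eb; last first.
  by have /eqP := nosq t x [::]; case; rewrite eb -!cats1 -catA.
apply: IHk => //.
- move=> i u v; apply: contra_neq (nosq i u (rcons v t)) => ->.
  by rewrite rcons_cat.
- move=> c cx; have /orP: (c == s) || (c == t).
    by have := sub c; rewrite mem_rcons inE cx orbT !inE; apply.
  by rewrite !inE orbC; move=> /orP.
- by rewrite last_rcons.
Qed.

Variables (V : zmodType) (sigma : I -> {additive V -> V}) (alpha : I -> V).
Variable pos : V -> Prop.

Definition word_act (u : seq I) (v : V) := foldr (fun i => sigma i) v u.

Hypothesis braid_act :
  forall i j v, word_act (flatten (nseq (m i j) [:: i; j])) v = v.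
Hypothesis sigma_root : forall i, sigma i (alpha i) = - alpha i.
Hypothesis dihedral : forall k i j, i != j -> (0 < k < m i j)%N ->
  exists a b, (0 < a + b)%N /\
    word_act (alt_word k i j) (alpha i) = alpha i *+ a + alpha j *+ b.
Hypothesis posD : forall v w, pos v -> pos w -> pos (v + w).
Hypothesis pos_root : forall i, pos (alpha i).
Hypothesis pos_opp : forall v, pos v -> ~ pos (- v).

Lemma word_act_cat u v x : word_act (u ++ v) x = word_act u (word_act v x).
Proof. exact: foldr_cat. Qed.

Lemma word_act_rel u v x : rel u v -> word_act u x = word_act v x.
Proof.
move=> uv; elim: uv x => {u v}
  [//|u v _ IH x|u v w _ IH1 _ IH2 x|u u' v v' _ IH1 _ IH2 x|i j x].
- by rewrite IH.
- by rewrite IH1.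
- by rewrite !word_act_cat IH2 IH1.
- exact: braid_act.
Qed.

Lemma word_actD u x y : word_act u (x + y) = word_act u x + word_act u y.
Proof. by elim: u => //= i u ->; rewrite raddfD. Qed.

Lemma word_actN u x : word_act u (- x) = - word_act u x.
Proof. by elim: u => //= i u ->; rewrite raddfN. Qed.

Lemma word_actMn u x k : word_act u (x *+ k) = word_act u x *+ k.
Proof. by elim: u => //= i u ->; rewrite raddfMn. Qed.

Lemma pos_comb v w a b :
  (0 < a + b)%N -> pos v -> pos w -> pos (v *+ a + w *+ b).
Proof.
have posM x k : pos x -> pos (x *+ k.+1).
  by move=> px; elim: k => // k IHk; rewrite mulrS; apply: posD.
case: a b => [|a] [|b] // _ pv pw; rewrite ?mulr0n ?add0r ?addr0;
  try exact: posM.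
by apply: posD; apply: posM.
Qed.

(** Tits: if appending [s] does not shorten the reduced word [w], then [w] sends
    the root of [s] to a positive element.  Let [t] be the last letter of [w],
    and factor [w] as [v ++ x] with [x] a word in [s] and [t] and [v] as short
    as possible.  By minimality appending [s] or [t] does not shorten [v], so by
    induction [v] sends both roots to positive elements; and [x] is an
    alternating word too short to be rewritten so as to end in [s], so it sends
    the root of [s] to a nonnegative combination of the two roots. *)
Lemma reduced_pos w s : reduced w ->
  (forall u, rel (rcons w s) u -> (size w <= size u)%N) ->
  pos (word_act w (alpha s)).
Proof.
have [n] := ubnP (size w); elim: n w s => // n IHn w s ltwn redw ws.
case/lastP Ew: w => [|w' t]; first exact: pos_root.
have st : s != t.
  apply/eqP => st; have : (size w <= size w')%N.
    apply: ws; rewrite Ew -!cats1 -st -!catA.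
    by have := cox_sq w' s [::]; rewrite cats0.
  by rewrite Ew size_rcons ltnn.
pose Q k := `[< exists v x, [/\ size v = k, rel (v ++ x) w,
  (size v + size x <= size w)%N & {subset x <= [:: s; t]}] >].
have Qw' : Q (size w').
  apply/asboolP; exists w', [:: t]; split=> //.
  - by rewrite Ew cats1; apply: CoxeterRefl.
  - by rewrite Ew size_rcons addn1.
  - by move=> c; rewrite !inE orbC => ->.
have exQ : exists k, Q k by exists (size w').
case: (ex_minnP exQ) => k /asboolP[v [x [<- vxw le_vx subx]]] vmin.
have eq_size : (size v + size x)%N = size w.
  by apply/eqP; rewrite eqn_leq le_vx -size_cat; apply/redw/CoxeterSym.
have ltvw : (size v < size w)%N.
  by rewrite Ew size_rcons; apply: vmin.
have redv : reduced v.
  move=> u vu; rewrite -(leq_add2r (size x)) eq_size -size_cat; apply: redw.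
  by apply: CoxeterTrans (CoxeterSym vxw) _; apply: cox_catr.
have v_pos c : c \in [:: s; t] -> pos (word_act v (alpha c)).
  move=> cst; apply: IHn => // [|u vcu]; first exact: leq_trans ltvw _.
  rewrite leqNgt; apply/negP => ltuv.
  (* u, a shorter form of v c, would give the better factorization (u, c x) *)
  have /vmin : Q (size u); last by rewrite leqNgt ltuv.
  apply/asboolP; exists u, (c :: x); split=> //.
  - apply: CoxeterTrans vxw; apply: (@CoxeterTrans _ _ _ (v ++ c :: c :: x)).
      by have := cox_catr (c :: x) vcu; rewrite cat_rcons => /CoxeterSym.
    exact: cox_sq.
  - by rewrite /= addnS -addSn -eq_size leq_add2r.
  - by move=> d; rewrite inE => /predU1P[->|/subx].
have last_x : last t x = t.
  case/lastP: x subx vxw eq_size {le_vx} => // x a sub vxw eq_size.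
  rewrite last_rcons; have : a \in [:: s; t].
    by apply: sub; rewrite mem_rcons inE eqxx.
  rewrite !inE => /orP[|] /eqP // as_.
  move: eq_size; rewrite size_rcons addnS => eq_size.
  have : (size w <= size (v ++ x))%N.
    apply: ws; rewrite -cats1.
    apply: CoxeterTrans (cox_catr [:: s] (CoxeterSym vxw)) _.
    have := cox_sq (v ++ x) s [::].
    by rewrite as_ -cats1 cats0 -!catA.
  by rewrite size_cat -eq_size ltnn.
have size_x : (size x).-1.+1 = size x.
  by rewrite prednK // -(ltn_add2l (size v)) addn0 eq_size.
have nosq i u z : x != u ++ i :: i :: z.
  apply/eqP => Ex; have : (size w <= size (v ++ u ++ z))%N.
    apply: redw; apply: CoxeterTrans (CoxeterSym vxw) _.
    by rewrite Ex !catA; apply: cox_sq.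
  by rewrite -eq_size Ex !size_cat /= leq_add2l leq_add2l ltnNge leqnSn.
have Ex := square_free_alt_word (esym size_x) nosq subx last_x.
rewrite size_x in Ex.
have ltxm : (size x < m s t)%N.
  (* otherwise the braid relation rewrites x so that it ends in s *)
  rewrite ltnNge; apply/negP => lemx.
  have [z] := alt_word_suffix (size x - m s t) (m s t) s t.
  rewrite subnK // -Ex; have := cox_alt s t; have := m_gt0 s t.
  case: (m s t) => // r _ /= cst Exz.
  have : (size w <= size (v ++ z ++ alt_word r s t))%N.
    apply: ws; rewrite -cats1.
    apply: CoxeterTrans (cox_catr [:: s] (CoxeterSym vxw)) _.
    rewrite Exz; apply: (@CoxeterTrans _ _ _
      ((v ++ z ++ rcons (alt_word r s t) s) ++ [:: s])).
      by apply: cox_catr; apply: cox_catl; apply: cox_catl.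
    have := cox_sq (v ++ z ++ alt_word r s t) s [::].
    by rewrite cats0 -!cats1 -!catA.
  rewrite -eq_size Exz !size_cat size_rcons !size_alt_word.
  by rewrite leq_add2l leq_add2l ltnn.
have [|a [b [ab_gt0 act_x]]] := @dihedral (size x) s t st.
  by rewrite ltxm -size_x.
rewrite -Ew -(word_act_rel _ vxw) word_act_cat {1}Ex act_x.
rewrite word_actD !word_actMn.
by apply: pos_comb => //; apply: v_pos; rewrite !inE eqxx ?orbT.
Qed.

(** If the reduced form of [u] is [v s], then [v] sends the root of [s] to a
    positive element, so [u] sends it to a negative one. *)
Lemma coxeter_faithful u :
  (forall i, pos (word_act u (alpha i))) -> rel u [::].
Proof.
move=> pos_u; have [v uv redv] := reduced_exists u.
case/lastP: v uv redv => // v s uv redv; exfalso.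
have /pos_opp[] : pos (word_act v (alpha s)).
  apply: reduced_pos => [w vw|w].
    rewrite -ltnS -(size_rcons v s) -(size_rcons w s) -!cats1.
    by rewrite -cats1 in redv; apply: redv; apply: cox_catr.
  by move/redv; rewrite size_rcons => /ltnW.
rewrite -word_actN -sigma_root -[sigma s _]/(word_act [:: s] (alpha s)).
by rewrite -word_act_cat cats1 -(word_act_rel _ uv).
Qed.

End CoxeterFaithful.

(** * The generators as rational maps of points *)

Section PointFunctions.
Variable K : comNzRingType.
Implicit Type x : seq K.

(** A point is the sequence of its coordinates, in the order of [star].  Sequences
    of another length only occur as degenerate cases: the rational maps below are
    the identity on them. *)
Definition vector_field x := if x is
    [:: q1; p1; q2; p2; q3; p3; q4; p4; t; a0; a1; a2; a3; a4] then
    [:: 2 * q1 ^+ 2 + p1 + 2 * t + 4 * p2 + 3 * p4;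
        - (4 * q1 * p1) + 2 * q2 * p2 - 2 * a0;
        q2 ^+ 2 - 4 * p2 + 4 * p1 - 2 * q1 * q2;
        - (2 * q2 * p2) + 2 * q1 * p2 - a1;
        q3 ^+ 2 - 4 * p3 + 4 * p4 - 2 * q3 * q4;
        - (2 * q3 * p3) + 2 * q4 * p3 - a3;
        2 * q4 ^+ 2 + p4 + 2 * t + 3 * p1 + 4 * p3;
        - (4 * q4 * p4) + 2 * q3 * p3 - 2 * a4;
        1; 0; 0; 0; 0; 0]
  else [::].

(** [f0], [f1], [f2] are the denominators of s_0, s_1, s_2; [f2] is the
    polynomial D. *)
Definition f0 x := 4 * x`_1 + x`_2 ^+ 2.
Definition f1 x := x`_3.
Definition f2 x :=
  2 * x`_1 + 4 * x`_3 + 4 * x`_5 + 2 * x`_7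
  + 2 * x`_0 * x`_2 - x`_2 * x`_4 + 2 * x`_4 * x`_6 + 4 * x`_8.
Definition sum_a x := x`_9 + x`_10 + x`_11 + x`_12 + x`_13.

Lemma sum_complement (a b c d : K) :
  1 - a - b - c - d + a + b + c + d = 1.
Proof. by ring. Qed.

Lemma complement_sum (s a b c d : K) :
  s = s + a + b + c + d - a - b - c - d.
Proof. by ring. Qed.

Lemma f2_ones x : f2 (nseq 9 1 ++ x) = 19%:R.
Proof. by rewrite /f2 /=; ring. Qed.

End PointFunctions.

Ltac case_point x := do 14! [case: x => [|? x] //]; case: x => [|//].

(** Entrywise hypotheses on a point are stored as one function of the index;
    [entries H] turns it into fourteen hypotheses. *)
Ltac entries H :=
  have := (H 0, H 1, H 2, H 3, H 4, H 5, H 6, H 7, H 8, H 9, H 10, H 11, H 12,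
           H 13)%N;
  rewrite /= => -[] [] [] [] [] [] [] [] [] [] [] [] [] ? ? ? ? ? ? ? ? ? ? ? ?
    ? ?.
Ltac case_index tac0 :=
  move=> [|[|[|[|[|[|[|[|[|[|[|[|[|[|?]]]]]]]]]]]]]] /=;
  [..|by rewrite !nth_nil; tac0].

Section Maps.
Variable F : fieldType.
Implicit Types x : seq F.

Definition s0_map x := if x is
    [:: q1; p1; q2; p2; q3; p3; q4; p4; t; a0; a1; a2; a3; a4] then
    [:: q1 + 4 * a0 / (4 * p1 + q2 ^+ 2); p1;
      q2; p2 - 2 * a0 * q2 / (4 * p1 + q2 ^+ 2);
      q3; p3; q4; p4; t;
      - a0; a1 + 2 * a0; a2; a3; a4]
  else x.

Definition s1_map x := if x is
    [:: q1; p1; q2; p2; q3; p3; q4; p4; t; a0; a1; a2; a3; a4] then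
    [:: q1; p1; q2 + a1 / p2; p2; q3; p3; q4; p4; t;
      a0 + a1; - a1; a2 + a1; a3; a4]
  else x.

Definition s2_map x := if x is
    [:: q1; p1; q2; p2; q3; p3; q4; p4; t; a0; a1; a2; a3; a4] then
    let D := 2 * p1 + 4 * p2 + 4 * p3 + 2 * p4
             + 2 * q1 * q2 - q2 * q3 + 2 * q3 * q4 + 4 * t in
    [:: q1 + 2 * a2 / D; p1 - 2 * a2 * q2 / D - 4 * a2 ^+ 2 / D ^+ 2;
      q2 + 4 * a2 / D; p2 - a2 * (2 * q1 - q3) / D;
      q3 + 4 * a2 / D; p3 - a2 * (2 * q4 - q2) / D;
      q4 + 2 * a2 / D; p4 - 2 * a2 * q3 / D - 4 * a2 ^+ 2 / D ^+ 2; t;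
      a0; a1 + a2; - a2; a3 + a2; a4]
  else x.

Definition pi_map x := if x is
    [:: q1; p1; q2; p2; q3; p3; q4; p4; t; a0; a1; a2; a3; a4] then
    [:: q4; p4; q3; p3; q2; p2; q1; p1; t; a4; a3; a2; a1; a0]
  else x.

(** Having s_3 and s_4 as conjugates makes half of the verifications below
    follow from the other half. *)
Definition s3_map x := pi_map (s1_map (pi_map x)).
Definition s4_map x := pi_map (s0_map (pi_map x)).

Lemma size_s0 x : size (s0_map x) = size x.
Proof. by case_point x. Qed.

Lemma size_s1 x : size (s1_map x) = size x.
Proof. by case_point x. Qed.

Lemma size_s2 x : size (s2_map x) = size x.
Proof. by case_point x. Qed.

Lemma size_pi x : size (pi_map x) = size x.
Proof. by case_point x. Qed.

Lemma sum_a_s0 x : sum_a (s0_map x) = sum_a x.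
Proof. by case_point x; rewrite /sum_a /=; ring. Qed.

Lemma sum_a_s1 x : sum_a (s1_map x) = sum_a x.
Proof. by case_point x; rewrite /sum_a /=; ring. Qed.

Lemma sum_a_s2 x : sum_a (s2_map x) = sum_a x.
Proof. by case_point x; rewrite /sum_a /=; ring. Qed.

Lemma sum_a_pi x : sum_a (pi_map x) = sum_a x.
Proof. by case_point x; rewrite /sum_a /=; ring. Qed.

Lemma f0_s0 x : f0 (s0_map x) = f0 x.
Proof. by case_point x. Qed.

Lemma f2_s2 x : f2 x != 0 -> f2 (s2_map x) = f2 x.
Proof. by case_point x; rewrite /f2 /= => n0; field. Qed.

Lemma f0_s2 x : f2 x != 0 -> f0 (s2_map x) = f0 x.
Proof. by case_point x; rewrite /f0 /f2 /= => n2; field. Qed.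

Lemma f2_s0 x : f0 x != 0 -> f2 (s0_map x) = f2 x.
Proof. by case_point x; rewrite /f0 /f2 /= => n0; field. Qed.

Lemma s0_mapK x : f0 x != 0 -> s0_map (s0_map x) = x.
Proof.
by case_point x; rewrite /f0 /= => n0; do ![congr (_ :: _)]; field.
Qed.

Lemma s1_mapK x : f1 x != 0 -> s1_map (s1_map x) = x.
Proof.
by case_point x; rewrite /f1 /= => n0; do ![congr (_ :: _)]; field.
Qed.

Lemma s2_mapK x : f2 x != 0 -> s2_map (s2_map x) = x.
Proof.
move=> n0; have := f2_s2 n0; move: n0; case_point x; rewrite /f2 /= => n0 ->.
by do ![congr (_ :: _)]; field.
Qed.

Lemma pi_mapK : involutive pi_map.
Proof. by move=> x; case_point x. Qed.

Lemma pi_s2 x : pi_map (s2_map (pi_map x)) = s2_map x.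
Proof.
have: f2 (pi_map x) = f2 x by case_point x; rewrite /f2 /=; ring.
by case_point x; rewrite /f2 /= => ->; do ![congr (_ :: _)]; ring.
Qed.

Lemma s0s2_comm x : f0 x != 0 -> f2 x != 0 ->
  s2_map (s0_map x) = s0_map (s2_map x).
Proof.
move=> n0 n2; have := f0_s2 n2; have := f2_s0 n0; move: n0 n2.
case_point x; rewrite /f0 /f2 /= => n0 n2 -> ->.
by do ![congr (_ :: _)]; field; rewrite ?n0 ?n2.
Qed.

Lemma s1s3_comm x : s3_map (s1_map x) = s1_map (s3_map x).
Proof.
by case_point x; rewrite /s3_map /=; do ![congr (_ :: _)]; ring.
Qed.

Lemma s0s3_comm x : s3_map (s0_map x) = s0_map (s3_map x).
Proof. by case_point x. Qed.

Lemma s0s4_comm x : s4_map (s0_map x) = s0_map (s4_map x).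
Proof. by case_point x. Qed.

(** The polynomials [n01], [n101] are the numerators of the images of [f0] and
    [f1] along one side of the relation, and [n10], [n010] of those along the
    other.  The relation has order 4 because the two sides then meet: the last
    image on each of them is a quotient of numerators already found ([d0101],
    [d1010]). *)
Lemma s0s1_braid x : f0 x != 0 -> f1 x != 0 ->
  f0 (s1_map x) != 0 -> f1 (s0_map x) != 0 ->
  f1 (s0_map (s1_map x)) != 0 -> f0 (s1_map (s0_map x)) != 0 ->
  s1_map (s0_map (s1_map (s0_map x))) = s0_map (s1_map (s0_map (s1_map x))).
Proof.
move: x => [|q1 [|p1 [|q2 [|p2 [|q3 [|p3 [|q4 [|p4 [|t [|a0 [|a1 [|a2
  [|a3 [|a4 [|? ?]]]]]]]]]]]]]]] //.
rewrite /f0 /f1 /=; set n0 := 4 * p1 + q2 ^+ 2.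
have -> : 4 * p1 = n0 - q2 ^+ 2 by rewrite /n0 addrK.
move: n0 => n0 h0 h1 h01 h10 h101 h010.
pose n01 := n0 * p2 ^+ 2 + 2 * q2 * p2 * a1 + a1 ^+ 2.
have d01 : n0 - q2 ^+ 2 + (q2 + a1 / p2) ^+ 2 = n01 / p2 ^+ 2.
  by rewrite /n01; field.
have n01_neq0 : n01 != 0 by move: h01; rewrite d01 mulf_eq0 => /norP[].
pose n10 := n0 * p2 - 2 * a0 * q2.
have d10 : p2 - 2 * a0 * q2 / n0 = n10 / n0 by rewrite /n10; field.
have n10_neq0 : n10 != 0 by move: h10; rewrite d10 mulf_eq0 => /norP[].
pose n101 := n01 - 2 * (a0 + a1) * (q2 * p2 + a1).
have d101 : p2 - 2 * (a0 + a1) * (q2 + a1 / p2) / (n01 / p2 ^+ 2) =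
    n101 * p2 / n01.
  by rewrite /n101; field; rewrite n01_neq0.
rewrite d01 d101 in h101 *.
have n101_neq0 : n101 != 0.
  by move: h101; rewrite !mulf_eq0 => /norP[/norP[]].
pose n010 := n10 ^+ 2 + 2 * q2 * (a1 + 2 * a0) * n10
             + (a1 + 2 * a0) ^+ 2 * n0.
have d010 : n0 - q2 ^+ 2 + (q2 + (a1 + 2 * a0) / (n10 / n0)) ^+ 2 =
    n010 * n0 / n10 ^+ 2.
  by rewrite /n010; field; rewrite h0 n10_neq0.
rewrite d10 d010 in h010 *.
have n010_neq0 : n010 != 0.
  by move: h010; rewrite !mulf_eq0 => /norP[/norP[]].
have d0101 : n0 - q2 ^+ 2
      + (q2 + a1 / p2 + (- a1 + 2 * (a0 + a1)) / (n101 * p2 / n01)) ^+ 2 =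
    n01 * n010 / n101 ^+ 2.
  rewrite /n010 /n10; move: n101_neq0 n01_neq0; rewrite /n101 /n01 => ? ?.
  by field; apply/and3P.
have d1010 : n10 / n0 -
    2 * (- a0 + (a1 + 2 * a0)) * (q2 + (a1 + 2 * a0) / (n10 / n0)) /
    (n010 * n0 / n10 ^+ 2) = n101 * n10 / n010.
  rewrite /n101 /n01; move: n010_neq0 n10_neq0; rewrite /n010 /n10 => ? ?.
  by field; apply/and3P.
rewrite d0101 d1010.
do ![congr (_ :: _)]; try by ring.
all: move: n010_neq0 n10_neq0 n101_neq0 n01_neq0.
all: rewrite /n010 /n10 /n101 /n01 => ? ? ? ?.
all: by field; do ?[apply/andP; split].
Qed.

(** Here 2 q_1 - q_3 is, up to sign, the Poisson bracket of [f1] and [f2], and it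
    is invariant under s_1 and s_2; this is why the images of [f1] and [f2] have
    the simple numerators [n12] and [n21]. *)
Lemma s1s2_braid x : f1 x != 0 -> f2 x != 0 ->
  f2 (s1_map x) != 0 -> f1 (s2_map x) != 0 ->
  s1_map (s2_map (s1_map x)) = s2_map (s1_map (s2_map x)).
Proof.
move: x => [|q1 [|p1 [|q2 [|p2 [|q3 [|p3 [|q4 [|p4 [|t [|a0 [|a1 [|a2
  [|a3 [|a4 [|? ?]]]]]]]]]]]]]]] //.
rewrite /f1 /f2 /= => h1.
pose D := 2 * p1 + 4 * p2 + 4 * p3 + 2 * p4 + 2 * q1 * q2 - q2 * q3
          + 2 * q3 * q4 + 4 * t.
rewrite -/D => h2.
pose n12 := p2 * D + a1 * (2 * q1 - q3).
pose n21 := p2 * D - a2 * (2 * q1 - q3).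
have -> : 2 * p1 + 4 * p2 + 4 * p3 + 2 * p4 + 2 * q1 * (q2 + a1 / p2) -
    (q2 + a1 / p2) * q3 + 2 * q3 * q4 + 4 * t = n12 / p2.
  by rewrite /n12 /D; field.
have -> : p2 - a2 * (2 * q1 - q3) / D = n21 / D by rewrite /n21; field.
rewrite !mulf_eq0 !invr_eq0 (negbTE h1) (negbTE h2) !orbF => h12 h21.
have d121 : p2 - (a2 + a1) * (2 * q1 - q3) / (n12 / p2) = p2 * n21 / n12.
  by move: h12; rewrite /n12 /n21 => ?; field; apply/andP.
rewrite d121.
match goal with |- context [q1 + 2 * a2 / D + _ / ?X] => set (D' := X) end.
have -> : D' = D * n12 / n21.
  (* eliminating t makes D an independent variable *)
  have tE : 4 * t = D - (2 * p1 + 4 * p2 + 4 * p3 + 2 * p4 + 2 * q1 * q2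
                         - q2 * q3 + 2 * q3 * q4) by rewrite /D; ring.
  rewrite /D' tE /n12; clear -h2 h21; clearbody D; rewrite /n21 in h21 *.
  by field; rewrite h2 h21.
clear D' d121; rewrite /n12 /n21 in h12 h21 *; clear n12 n21; clearbody D.
by do ![congr (_ :: _)]; try ring; field; do ?[apply/andP; split].
Qed.

End Maps.

(** * The maps and field operations *)

Section RationalRelation.
Variables F K : fieldType.

(** The graph of a field morphism is such a relation, but so is the graph of the
    evaluation of fractions at a point, which is only partially defined. *)
Record rational_rel (r : F -> K -> Prop) : Prop := RationalRel {
  rat1 : r 1 1;
  ratD : forall a a' b b', r a a' -> r b b' -> r (a + b) (a' + b');
  ratN : forall a a', r a a' -> r (- a) (- a');
  ratM : forall a a' b b', r a a' -> r b b' -> r (a * b) (a' * b');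
  ratV : forall a a', a' != 0 -> r a a' -> r a^-1 a'^-1 }.

Variables (r : F -> K -> Prop) (rP : rational_rel r).

Lemma rat0 : r 0 0.
Proof.
rewrite -(subrr 1) -[in X in r _ X](subrr 1).
by apply: (ratD rP) (ratN rP _); apply: (rat1 rP).
Qed.

Lemma rat_nat n : r n%:R n%:R.
Proof.
elim: n => [|n IHn]; first exact: rat0.
by rewrite !mulrS; apply: (ratD rP) (rat1 rP) IHn.
Qed.

Definition related (x : seq F) (y : seq K) :=
  size x = size y /\ forall k, r x`_k y`_k.

Ltac case_points x y :=
  move: x y => [|? [|? [|? [|? [|? [|? [|? [|? [|? [|? [|? [|? [|? [|? [|? ?]]]]]]]
    ]]]]]]]] [|? [|? [|? [|? [|? [|? [|? [|? [|? [|? [|? [|? [|? [|? [|? ?]]]]]]]]]]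
    ]]]]] [] //=.
Ltac related_tac fx :=
  split=> //; entries fx; case_index ltac:(apply: rat0); rewrite ?expr2 ?invfM;
  repeat first [ assumption | apply: rat_nat | apply: (ratD rP)
   | apply: (ratN rP) | apply: (ratM rP) | apply: (ratV rP) ].

Lemma related_s0 x y :
  related x y -> f0 y != 0 -> related (s0_map x) (s0_map y).
Proof. by case_points x y; rewrite /f0 /= => _ fx n0; related_tac fx. Qed.

Lemma related_s1 x y :
  related x y -> f1 y != 0 -> related (s1_map x) (s1_map y).
Proof. by case_points x y; rewrite /f1 /= => _ fx n1; related_tac fx. Qed.

Lemma related_s2 x y :
  related x y -> f2 y != 0 -> related (s2_map x) (s2_map y).
Proof. by case_points x y; rewrite /f2 /= => _ fx n2; related_tac fx. Qed.

Lemma related_pi x y : related x y -> related (pi_map x) (pi_map y).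
Proof. by case_points x y; move=> _ fx; related_tac fx. Qed.

End RationalRelation.

Section MapPoint.
Lemma nth_map_add (U V : zmodType) (f : {additive U -> V}) s k :
  (map f s)`_k = f s`_k.
Proof.
have [ltk|lek] := ltnP k (size s); first exact: nth_map.
by rewrite !nth_default ?size_map ?raddf0.
Qed.

Section Ring.
Variables (K L : comNzRingType) (f : {rmorphism K -> L}).
Let fE := (nth_map_add, rmorphD f, rmorphN f, rmorphM f, rmorphXn f,
           rmorph_nat f, rmorph0 f, rmorph1 f).

Lemma map_f0 x : f (f0 x) = f0 (map f x).
Proof. by rewrite /f0 !fE. Qed.

Lemma map_f1 x : f (f1 x) = f1 (map f x).
Proof. by rewrite /f1 !fE. Qed.

Lemma map_f2 x : f (f2 x) = f2 (map f x).
Proof. by rewrite /f2 !fE. Qed.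

Lemma map_vector_field x : map f (vector_field x) = vector_field (map f x).
Proof. by case_point x; rewrite /= !fE. Qed.

End Ring.

Section Field.
Variables (F K : fieldType) (f : {rmorphism F -> K}).
Let fE := (rmorphD f, rmorphN f, rmorphM f, rmorphXn f, fmorphV f,
           rmorph_nat f).

Lemma map_s0 x : map f (s0_map x) = s0_map (map f x).
Proof. by case_point x; rewrite /= !fE. Qed.

Lemma map_s1 x : map f (s1_map x) = s1_map (map f x).
Proof. by case_point x; rewrite /= !fE. Qed.

Lemma map_s2 x : map f (s2_map x) = s2_map (map f x).
Proof. by case_point x; rewrite /= !fE. Qed.

Lemma map_pi x : map f (pi_map x) = pi_map (map f x).
Proof. by case_point x. Qed.

End Field.
End MapPoint.

(** * Invariance of the vector field *)

Section Derivation.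
Variable F : fieldType.

(** A derivation given by its graph; on fractions this avoids choosing a
    numerator and a denominator. *)
Record derivation_rel (r : F -> F -> Prop) : Prop := DerivationRel {
  der1 : r 1 0;
  derD : forall a a' b b', r a a' -> r b b' -> r (a + b) (a' + b');
  derN : forall a a', r a a' -> r (- a) (- a');
  derM : forall a a' b b', r a a' -> r b b' -> r (a * b) (a' * b + a * b');
  derV : forall a a', a != 0 -> r a a' -> r a^-1 (- a' / a ^+ 2) }.

Variables (r : F -> F -> Prop) (rP : derivation_rel r).

Lemma der0 : r 0 0.
Proof.
rewrite -{1}(subrr 1) -(subrr 0).
by apply: (derD rP) (derN rP _); apply: (der1 rP).
Qed.

Lemma der_nat n : r n%:R 0.
Proof.
elim: n => [|n IHn]; first exact: der0.
by rewrite mulrS -(addr0 0); apply: derD (der1 rP) IHn.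
Qed.

Lemma der_eq a b c : r a b -> b = c -> r a c.
Proof. by move=> rab <-. Qed.

(** Computes a derivative by the rules of calculus, leaving an equation. *)
Ltac der_solve :=
  apply: der_eq; first (rewrite ?expr2 ?invfM; repeat first
   [ eassumption | apply: der_nat | apply: (derD rP) | apply: (derN rP)
   | apply: (derM rP) | apply: (derV rP) ]).

Definition flows (x : seq F) := forall k, r x`_k (vector_field x)`_k.

Ltac flows_tac fx := entries fx; case_index ltac:(apply: der0); der_solve.

Lemma s0_flows x : f0 x != 0 -> flows x -> flows (s0_map x).
Proof. by case_point x; rewrite /f0 /= => n0 fx; flows_tac fx; field. Qed.

Lemma s1_flows x : f1 x != 0 -> flows x -> flows (s1_map x).
Proof. by case_point x; rewrite /f1 /= => n1 fx; flows_tac fx; field. Qed.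

(** For alpha_2 = 0 this makes D = 0 an invariant hypersurface, the wall of s_2.
    The normalization of the parameters enters through the constant 4 alpha_2. *)
Lemma f2_flow x : size x = 14%N -> sum_a x = 1 -> flows x ->
  r (f2 x) ((x`_2 + x`_4) * f2 x + 4 * x`_11).
Proof.
move: x => [|q1 [|p1 [|q2 [|p2 [|q3 [|p3 [|q4 [|p4 [|t [|a0 [|a1 [|a2
  [|a3 [|a4 [|? ?]]]]]]]]]]]]]]] //.
rewrite /f2 /sum_a /= => _ suma fx.
have a2E : a2 = 1 - a0 - a1 - a3 - a4 by rewrite -suma; ring.
by entries fx; der_solve; rewrite a2E; ring.
Qed.

Lemma s2_flows x : size x = 14%N -> f2 x != 0 -> sum_a x = 1 ->
  flows x -> flows (s2_map x).
Proof.
move=> sx n2 suma fx; have := f2_flow sx suma fx; move: sx n2 fx {suma}.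
move: x => [|q1 [|p1 [|q2 [|p2 [|q3 [|p3 [|q4 [|p4 [|t [|a0 [|a1 [|a2
  [|a3 [|a4 [|? ?]]]]]]]]]]]]]]] //.
rewrite /f2 /=; set D := 2 * _ + 4 * _ + _ + _ + _ - _ + _ + _.
(* only these two equations depend on the definition of D, which can otherwise be
   treated as an independent variable *)
have q1E : 2 * (2 * q1 ^+ 2 + p1 + 2 * t + 4 * p2 + 3 * p4)
    = D + 4 * q1 ^+ 2 + 4 * p2 + 4 * p4 - 4 * p3 - 2 * q1 * q2 + q2 * q3
      - 2 * q3 * q4 by rewrite /D; ring.
have q4E : 2 * (2 * q4 ^+ 2 + p4 + 2 * t + 3 * p1 + 4 * p3)
    = D + 4 * q4 ^+ 2 + 4 * p3 + 4 * p1 - 4 * p2 - 2 * q1 * q2 + q2 * q3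
      - 2 * q3 * q4 by rewrite /D; ring.
move: (D) q1E q4E => {}D q1E q4E _ n2 fx rD.
by flows_tac fx; rewrite ?q1E ?q4E; field.
Qed.

Lemma pi_flows x : flows x -> flows (pi_map x).
Proof. by case_point x; move=> fx; flows_tac fx; ring. Qed.

End Derivation.

(** * Fields of fractions *)

Section Fractions.
Variables (A : idomainType) (K : fieldType).

Lemma tofrac_ratio (f : {fraction A}) : exists n d : A,
  d != 0 /\ f = tofrac n / tofrac d.
Proof.
elim/quotW: f => x; exists (frac x).1, (frac x).2; split; first exact: denom_ratioP.
apply: (canRL (mulfK _)); first by rewrite tofrac_eq0 denom_ratioP.
unlock tofrac; rewrite -[LHS]FracField.pi_mul; apply/eqmodP; rewrite /= equivfE.
by rewrite !numden_Ratio ?mulf_neq0 ?oner_eq0 ?denom_ratioP // !mulr1 mulrC.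
Qed.

Section Value.
Variable phi : {rmorphism A -> K}.

(** For [phi] the evaluation of polynomials at a point, this is the evaluation of
    fractions, undefined where every denominator vanishes. *)
Definition value (f : {fraction A}) (c : K) := exists n d : A,
  [/\ f = tofrac n / tofrac d, phi d != 0 & c = phi n / phi d].

Lemma value_unique f c c' : value f c -> value f c' -> c = c'.
Proof.
move=> [n [d [-> d0 ->]]] [n' [d' [e d'0 ->]]].
have dn0 : d != 0 by apply: contraNneq d0 => ->; rewrite rmorph0.
have d'n0 : d' != 0 by apply: contraNneq d'0 => ->; rewrite rmorph0.
apply/eqP; rewrite eqr_div //; apply/eqP; rewrite -!rmorphM; congr (phi _).
apply/eqP; rewrite -tofrac_eq !tofracM -eqr_div ?tofrac_eq0 //; exact/eqP.
Qed.

Lemma value_tofrac p : value (tofrac p) (phi p).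
Proof. by exists p, 1; rewrite !rmorph1 !divr1 oner_neq0. Qed.

Lemma value_rational : rational_rel value.
Proof.
split.
- by have := value_tofrac 1; rewrite !rmorph1.
- move=> _ _ _ _ [n [d [-> d0 ->]]] [n' [d' [-> d'0 ->]]].
  exists (n * d' + n' * d), (d * d'); split.
  + rewrite !tofracD !tofracM addf_div ?tofrac_eq0 //.
    * by apply: contraNneq d0 => ->; rewrite rmorph0.
    * by apply: contraNneq d'0 => ->; rewrite rmorph0.
  + by rewrite rmorphM mulf_neq0.
  + by rewrite !rmorphD !rmorphM addf_div.
- move=> _ _ [n [d [-> d0 ->]]]; exists (- n), d; split=> //.
    by rewrite tofracN mulNr.
  by rewrite rmorphN mulNr.
- move=> _ _ _ _ [n [d [-> d0 ->]]] [n' [d' [-> d'0 ->]]].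
  exists (n * n'), (d * d'); split; first by rewrite !tofracM mulf_div.
    by rewrite rmorphM mulf_neq0.
  by rewrite !rmorphM mulf_div.
- move=> f a nd0 [n [d [-> d0 ea]]]; rewrite ea in nd0 *; exists d, n; split.
  + by rewrite invf_div.
  + by apply: contraNneq nd0 => ->; rewrite mul0r.
  + by rewrite invf_div.
Qed.

Hypothesis phi_inj : injective phi.

Lemma frac_lift : exists psi : {rmorphism {fraction A} -> K},
  forall p, psi (tofrac p) = phi p.
Proof.
have val f : exists c, value f c.
  have [n [d [d0 ->]]] := tofrac_ratio f; exists (phi n / phi d), n, d; split=> //.
  by rewrite (raddf_eq0 _ phi_inj).
pose psi f := projT1 (cid (val f)).
have psiP f : value f (psi f) := projT2 (cid (val f)).
have psiB : zmod_morphism psi.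
  move=> f g; apply: value_unique (psiP _) _.
  by apply: (ratD value_rational) => //; apply: (ratN value_rational).
have psiM : monoid_morphism psi.
  split; first exact: value_unique (psiP _) (rat1 value_rational).
  move=> f g; apply: value_unique (psiP _) _.
  exact: (ratM value_rational).
pose psiA := GRing.isZmodMorphism.Build _ _ psi psiB.
pose psiMM := GRing.isMonoidMorphism.Build _ _ psi psiM.
pose Psi : {rmorphism _ -> _} := HB.pack psi psiA psiMM.
by exists Psi => p; apply: value_unique (psiP _) (value_tofrac p).
Qed.
End Value.
End Fractions.

Section QuotientRule.
Variables (K : fieldType) (n d n' d' dn dd dn' dd' : K).
Hypotheses (d0 : d != 0) (d'0 : d' != 0).
Local Notation quot_der n d dn dd := ((dn * d - n * dd) / d ^+ 2).

Lemma quot_derD :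
  quot_der n d dn dd + quot_der n' d' dn' dd' =
  quot_der (n * d' + n' * d) (d * d')
    (dn * d' + n * dd' + (dn' * d + n' * dd)) (dd * d' + d * dd').
Proof. by field; rewrite ?d0 ?d'0. Qed.

Lemma quot_derN : - quot_der n d dn dd = quot_der (- n) d (- dn) dd.
Proof. by field. Qed.

Lemma quot_derM :
  quot_der n d dn dd * (n' / d') + n / d * quot_der n' d' dn' dd' =
  quot_der (n * n') (d * d') (dn * n' + n * dn') (dd * d' + d * dd').
Proof. by field; rewrite ?d0 ?d'0. Qed.

Lemma quot_derV : n != 0 ->
  - quot_der n d dn dd / (n / d) ^+ 2 = quot_der d n dd dn.
Proof. by move=> n0; field; rewrite ?n0 ?d0. Qed.

Lemma quotient_rule :
  dn * d^-1 + n * (- dd / d ^+ 2) = quot_der n d dn dd.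
Proof. by field. Qed.

End QuotientRule.

Section FractionDerivation.
Variables (A : idomainType) (delta : A -> A).
Hypothesis deltaD : {morph delta : p q / p + q}.
Hypothesis deltaM : forall p q, delta (p * q) = delta p * q + p * delta q.
Local Notation F := {fraction A}.

(** The graph of the extension of [delta] to fractions. *)
Definition is_der (f g : F) := exists n d : A,
  [/\ d != 0, f = tofrac n / tofrac d &
   g = tofrac (delta n * d - n * delta d) / tofrac d ^+ 2].

Lemma delta0 : delta 0 = 0.
Proof. by apply: (addIr (delta 0)); rewrite -deltaD !add0r. Qed.

Lemma deltaN p : delta (- p) = - delta p.
Proof. by apply/eqP; rewrite -addr_eq0 -deltaD addNr delta0. Qed.

Lemma delta1 : delta 1 = 0.
Proof.
by apply: (addIr (delta 1)); rewrite add0r -[in RHS](mulr1 1) deltaM mulr1 mul1r.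
Qed.

Lemma is_der_unique f g g' : is_der f g -> is_der f g' -> g = g'.
Proof.
move=> [n [d [d0 -> ->]]] [n' [d' [d'0 e ->]]].
have {}e : n * d' = n' * d.
  apply/eqP; rewrite -tofrac_eq !tofracM -eqr_div ?tofrac_eq0 //; exact/eqP.
apply/eqP; rewrite eqr_div ?expf_eq0 ?tofrac_eq0 //=.
rewrite -!tofracXn -!tofracM tofrac_eq -subr_eq0.
have /eqP := congr1 (fun p => delta p * (d * d')) e.
rewrite !deltaM -subr_eq0 => e'.
have -> : (delta n * d - n * delta d) * d' ^+ 2
      - (delta n' * d' - n' * delta d') * d ^+ 2 =
    (delta n * d' + n * delta d') * (d * d')
      - (delta n' * d + n' * delta d) * (d * d')
      - (n * d' - n' * d) * (delta d * d' + delta d' * d) by ring.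
by rewrite (eqP e') e subrr mul0r subrr.
Qed.

Lemma is_der_tofrac p : is_der (tofrac p) (tofrac (delta p)).
Proof.
exists p, 1; rewrite oner_neq0 tofrac1 expr1n !divr1 delta1.
by rewrite mulr0 subr0 mulr1.
Qed.

Lemma is_der_rel : derivation_rel is_der.
Proof.
split.
- by have := is_der_tofrac 1; rewrite delta1 tofrac0 tofrac1.
- move=> _ _ _ _ [n [d [d0 -> ->]]] [n' [d' [d'0 -> ->]]].
  exists (n * d' + n' * d), (d * d'); rewrite mulf_neq0 //.
  rewrite !(deltaD, deltaM, tofracD, tofracM, tofracN) addf_div ?tofrac_eq0 //.
  by split=> //; rewrite quot_derD ?tofrac_eq0.
- move=> _ _ [n [d [d0 -> ->]]].
  exists (- n), d; rewrite deltaN !(tofracD, tofracM, tofracN) mulNr.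
  by split=> //; rewrite quot_derN ?tofrac_eq0.
- move=> _ _ _ _ [n [d [d0 -> ->]]] [n' [d' [d'0 -> ->]]].
  exists (n * n'), (d * d'); rewrite mulf_neq0 //.
  rewrite !(deltaD, deltaM, tofracD, tofracM, tofracN) mulf_div.
  by split=> //; rewrite quot_derM ?tofrac_eq0.
- move=> f g nd0 [n [d [d0 ef eg]]].
  have n0 : n != 0 by apply: contraNneq nd0 => n0; rewrite ef n0 tofrac0 mul0r.
  exists d, n; rewrite n0 ef eg invf_div !(tofracD, tofracM, tofracN).
  by split=> //; rewrite quot_derV ?tofrac_eq0.
Qed.

End FractionDerivation.

(** * Polynomials *)

Section MPolyRing.
Variables (n : nat) (C : comNzRingType).
Local Notation A := (mpoly n C).

Lemma mpoly_ring_ind (P : A -> Prop) :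
  (forall c, P (mpolyC n c)) -> (forall k, P (mpolyX C (mnm1 k))) ->
  (forall p q, P p -> P q -> P (p + q)) ->
  (forall p q, P p -> P q -> P (p * q)) -> forall p, P p.
Proof.
move=> PC PX PD PM; apply: mpolyind => [|c m p _ _ Pp].
  by rewrite -mpolyC0; apply/PC.
apply: PD => //; rewrite -mul_mpolyC; apply/PM => //.
rewrite mpolyXE_id; apply: big_ind => [||k _].
- by rewrite -mpolyC1; apply: PC.
- exact/PM.
elim: (m k) => [|r IHr]; first by rewrite expr0 -mpolyC1; apply/PC.
by rewrite exprS; apply/PM.
Qed.

Variable V : 'I_n -> A.
(** The derivation with coefficients [V]. *)
Definition field_deriv (p : A) : A := \sum_k mderiv k p * V k.

Lemma field_derivD : {morph field_deriv : p q / p + q}.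
Proof.
move=> p q; rewrite -big_split; apply: eq_bigr => k _.
by rewrite mderivD mulrDl.
Qed.

Lemma field_derivM p q :
  field_deriv (p * q) = field_deriv p * q + p * field_deriv q.
Proof.
rewrite /field_deriv mulr_suml mulr_sumr -big_split; apply: eq_bigr => k _ /=.
by rewrite mderivM; ring.
Qed.

Lemma field_derivC c : field_deriv (mpolyC n c) = 0.
Proof. by rewrite /field_deriv big1 // => k _; rewrite mderivC mul0r. Qed.

Lemma field_derivX k : field_deriv (mpolyX C (mnm1 k)) = V k.
Proof.
rewrite /field_deriv (bigD1 k) //= big1 => [|j jk].
  rewrite mderivX mnm1E eqxx scale1r addr0.
  rewrite (_ : mnm_sub _ _ = mnm0) ?mpolyX0 ?mul1r //.
  by apply/mnmP => j; rewrite mnmBE subnn mnm0E.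
by rewrite mderivX mnm1E eq_sym (negbTE jk) scale0r mul0r.
Qed.

End MPolyRing.

(** * Substitutions in rational functions *)

Section RatFunMorphisms.
Variable R : realType.
Local Notation C := (Cx R).
Local Notation A := (mpoly 13 C).
Local Notation F := (RatFun R).

Definition pcoord k : A := mpolyX C (mnm1 (inord k)).

(** The generic point has polynomial entries; working with them allows
    evaluation at arbitrary points. *)
Definition star_poly : seq A :=
  [:: pcoord 0; pcoord 1; pcoord 2; pcoord 3; pcoord 4; pcoord 5; pcoord 6;
      pcoord 7; pcoord 8; 1 - pcoord 9 - pcoord 10 - pcoord 11 - pcoord 12;
      pcoord 9; pcoord 10; pcoord 11; pcoord 12].

Lemma star_frac : star R = map (@tofrac _) star_poly.
Proof. by rewrite /star /= !rmorphB rmorph1. Qed.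

(** The index shift skips alpha_0, which is not a coordinate. *)
Lemma star_poly_bump (k : 'I_13) : star_poly`_(bump 9 k) = mpolyX C (mnm1 k).
Proof.
rewrite -{2}(inord_val k).
by case: k => [[|[|[|[|[|[|[|[|[|[|[|[|[|]]]]]]]]]]]]] lt_k].
Qed.

Lemma star_bump (k : 'I_13) : (star R)`_(bump 9 k) = coord R k.
Proof. by rewrite star_frac nth_map_add star_poly_bump. Qed.

Lemma size_star : size (star R) = 14%N. Proof. by []. Qed.

Lemma sum_a_star : sum_a (star R) = 1.
Proof. exact: sum_complement. Qed.

(** The rational functions are generated by the constants and the entries of
    [star]. *)
Lemma ratfun_ext (K : fieldType) (f g : {rmorphism F -> K}) :
  (forall c, f (cst c) = g (cst c)) -> map f (star R) = map g (star R) -> f =1 g.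
Proof.
move=> fgC fgX h.
have fgA p : f (tofrac p) = g (tofrac p).
  elim/mpoly_ring_ind: p => [c|k|p q ep eq|p q ep eq].
  - exact: fgC.
  - rewrite -[tofrac _]/(coord R k) -star_bump.
    by rewrite -(nth_map_add f) fgX nth_map_add.
  - by rewrite !rmorphD ep eq.
  - by rewrite !rmorphM ep eq.
have [n [d [_ ->]]] := tofrac_ratio h.
by rewrite !fmorph_div !fgA.
Qed.

Section Substitution.
Variable y : seq F.
Hypothesis size_y : size y = 14%N.
Hypothesis sum_y : sum_a y = 1.

Definition subst_mpoly : {rmorphism A -> F} :=
  mmap (@tofrac A \o @mpolyC 13 C) (fun k => y`_(bump 9 k)).

Lemma subst_mpolyC c : subst_mpoly (mpolyC 13 c) = cst c.
Proof. exact: mmapC. Qed.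

Lemma subst_mpolyX k : subst_mpoly (mpolyX C (mnm1 k)) = y`_(bump 9 k).
Proof. by rewrite /= mmapX mmap1U. Qed.

Lemma subst_star_poly : map subst_mpoly star_poly = y.
Proof.
have yX i : (i < 13)%N -> subst_mpoly (pcoord i) = y`_(bump 9 i).
  by move=> lti; rewrite subst_mpolyX inordK.
have suby : y`_9 = 1 - y`_10 - y`_11 - y`_12 - y`_13.
  rewrite -sum_y; exact: complement_sum.
transitivity (mkseq (nth 0 y) 14); last by rewrite -size_y mkseq_nth.
by rewrite [map _ _]/= !rmorphB rmorph1 !yX // -suby.
Qed.

Lemma value_star : related (value subst_mpoly) (star R) y.
Proof.
split=> [|k]; first by rewrite size_y.
rewrite star_frac -subst_star_poly !nth_map_add.
exact: value_tofrac.
Qed.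

(** If the rational functions [y] take at the point [y] the values [star], then
    evaluation at [y] recovers [p] from [p] at [y]. *)
Lemma subst_mpoly_inj : related (value subst_mpoly) y (star R) ->
  injective subst_mpoly.
Proof.
move=> [_ val_y].
have val p : value subst_mpoly (subst_mpoly p) (tofrac p).
  elim/mpoly_ring_ind: p => [c|k|p q vp vq|p q vp vq].
  - rewrite subst_mpolyC -[tofrac _]/(cst c) -{2}(subst_mpolyC c).
    exact: value_tofrac.
  - by rewrite subst_mpolyX -[tofrac _]/(coord R k) -star_bump; apply: val_y.
  - by rewrite !rmorphD; apply: (ratD (value_rational _)).
  - by rewrite !rmorphM; apply: (ratM (value_rational _)).
move=> p q epq; have := val p; rewrite epq => /(value_unique (val q))/eqP.
by rewrite tofrac_eq => /eqP.
Qed.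

Lemma substitution : related (value subst_mpoly) y (star R) ->
  exists f : {rmorphism F -> F}, (forall c, f (cst c) = cst c) /\
    map f (star R) = y.
Proof.
move=> /subst_mpoly_inj/frac_lift[f fE]; exists f; split=> [c|].
  by rewrite fE subst_mpolyC.
rewrite star_frac -map_comp -[RHS]subst_star_poly.
by apply: eq_map => p; apply: fE.
Qed.

End Substitution.

(** The maps of the generators are involutions compatible with evaluation, which
    is all that the injectivity argument needs. *)
Lemma substitution_invol (E : seq F -> seq F) :
  (forall x, size (E x) = size x) -> (forall x, sum_a (E x) = sum_a x) ->
  (forall r : F -> F -> Prop, rational_rel r -> forall x,
     related r x (E (star R)) -> related r (E x) (E (E (star R)))) ->
  E (E (star R)) = star R ->
  exists f : {rmorphism F -> F}, (forall c, f (cst c) = cst c) /\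
    map f (star R) = E (star R).
Proof.
move=> sizeE sumE relE EK; have sE : size (E (star R)) = 14%N by rewrite sizeE.
have aE : sum_a (E (star R)) = 1 by rewrite sumE sum_a_star.
apply: (substitution sE aE).
by have := relE _ (value_rational _) _ (value_star sE aE); rewrite EK.
Qed.

(** Used to see that the denominators of the generators are not identically zero,
    by evaluating them where all coordinates are 1. *)
Lemma tofrac_neq0 (v : 'I_13 -> C) (p : A) : meval v p != 0 -> tofrac p != 0.
Proof.
by apply: contraNneq => /eqP; rewrite tofrac_eq0 => /eqP ->; rewrite meval0.
Qed.

Lemma map_meval_star v : map (meval v) star_poly =
  [:: v (inord 0); v (inord 1); v (inord 2); v (inord 3); v (inord 4);
      v (inord 5); v (inord 6); v (inord 7); v (inord 8);
      1 - v (inord 9) - v (inord 10) - v (inord 11) - v (inord 12);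
      v (inord 9); v (inord 10); v (inord 11); v (inord 12)].
Proof.
by rewrite /star_poly /pcoord [map _ _]/= !mevalB meval1 !mevalXU; reflexivity.
Qed.

Lemma f0_star : f0 (star R) != 0.
Proof.
rewrite star_frac -map_f0; apply: (@tofrac_neq0 (fun=> 1)).
by rewrite map_f0 map_meval_star /f0 /= mulr1 expr1n natr1 pnatr_eq0.
Qed.

Lemma f1_star : f1 (star R) != 0.
Proof.
rewrite star_frac -map_f1; apply: (@tofrac_neq0 (fun=> 1)).
by rewrite map_f1 map_meval_star /f1 /= oner_eq0.
Qed.

Lemma f2_star : f2 (star R) != 0.
Proof.
rewrite star_frac -map_f2; apply: (@tofrac_neq0 (fun=> 1)).
by rewrite map_f2 map_meval_star f2_ones pnatr_eq0.
Qed.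

Lemma exists_s0 : exists f : {rmorphism F -> F},
  (forall c, f (cst c) = cst c) /\ map f (star R) = s0_map (star R).
Proof.
apply: (substitution_invol (E := @s0_map F)) (@size_s0 F) (@sum_a_s0 F) _
  (s0_mapK f0_star).
by move=> r rP x rx; apply: related_s0 => //; rewrite f0_s0 f0_star.
Qed.

Lemma exists_s1 : exists f : {rmorphism F -> F},
  (forall c, f (cst c) = cst c) /\ map f (star R) = s1_map (star R).
Proof.
apply: (substitution_invol (E := @s1_map F)) (@size_s1 F) (@sum_a_s1 F) _
  (s1_mapK f1_star).
by move=> r rP x rx; apply: related_s1 => //; apply: f1_star.
Qed.

Lemma exists_s2 : exists f : {rmorphism F -> F},
  (forall c, f (cst c) = cst c) /\ map f (star R) = s2_map (star R).
Proof.
apply: (substitution_invol (E := @s2_map F)) (@size_s2 F) (@sum_a_s2 F) _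
  (s2_mapK f2_star).
by move=> r rP x rx; apply: related_s2 => //; rewrite f2_s2 f2_star.
Qed.

Lemma exists_pi : exists f : {rmorphism F -> F},
  (forall c, f (cst c) = cst c) /\ map f (star R) = pi_map (star R).
Proof.
apply: (substitution_invol (E := @pi_map F)) (@size_pi F) (@sum_a_pi F) _
  (pi_mapK _).
by move=> r rP x rx; apply: related_pi.
Qed.

End RatFunMorphisms.

(** * Derivatives along solutions *)

Section ScalarDerivative.
Local Open Scope classical_set_scope.
Variable K : numFieldType.
Implicit Types (f g : K -> K) (t df dg : K).

Lemma is_derive_add f g t df dg :
  is_derive t (1 : K) f df -> is_derive t (1 : K) g dg ->
  is_derive t (1 : K) (fun u => f u + g u) (df + dg).
Proof. exact: is_deriveD. Qed.

Lemma is_derive_mul f g t df dg :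
  is_derive t (1 : K) f df -> is_derive t (1 : K) g dg ->
  is_derive t (1 : K) (fun u => f u * g u) (df * g t + f t * dg).
Proof.
move=> Df Dg; apply: is_derive_eq (is_deriveM Df Dg) _.
by rewrite -![_ *: _]/(_ * _) addrC [X in X + _]mulrC.
Qed.

Lemma is_derive_quotient f g t df dg : g t != 0 ->
  is_derive t (1 : K) f df -> is_derive t (1 : K) g dg ->
  is_derive t (1 : K) (fun u => f u / g u) ((df * g t - f t * dg) / g t ^+ 2).
Proof.
move=> g0 Df Dg.
have Dg' : is_derive t (1 : K) (fun u => (g u)^-1) (- (g t) ^- 2 *: dg).
  apply: DeriveDef; first exact: derivableV.
  by rewrite deriveV // derive_val.
apply: is_derive_eq (is_derive_mul Df Dg') _.
by rewrite -![_ *: _]/(_ * _); field.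
Qed.

Lemma is_derive_near_neq0 f t df : is_derive t (1 : K) f df -> f t != 0 ->
  \forall u \near t, f u != 0.
Proof.
move=> Df f0.
have cf : {for t, continuous f}.
  by apply/differentiable_continuous/derivable1_diffP.
have o0 : open (~` [set (0 : K)]).
  apply: closed_openC; apply: accessible_closed_set1.
  by apply: hausdorff_accessible; apply: norm_hausdorff.
have nf : nbhs t [set u | (~` [set (0 : K)]) (f u)] :=
  cf _ (open_nbhs_nbhs (conj o0 (elimN eqP f0))).
by apply: (@filterS _ _ _ _ _ _ nf) => u /eqP.
Qed.

End ScalarDerivative.

Section Backlund.
Local Open Scope classical_set_scope.
Variable R : realType.
Local Notation C := (Cx R).
Local Notation A := (mpoly 13 C).
Local Notation F := (RatFun R).
Implicit Types (U : set C) (x y : C -> 'I_13 -> C).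

Definition flow_coef (k : 'I_13) : A := (vector_field (star_poly R))`_(bump 9 k).
Definition flow : A -> A := field_deriv flow_coef.

Lemma meval_flow_coef (v : 'I_13 -> C) k :
  meval v (flow_coef k) = (vector_field (map (meval v) (star_poly R)))`_(bump 9 k).
Proof. by rewrite /flow_coef -nth_map_add map_vector_field. Qed.

Lemma solution_curve_derive U x : open U -> solution_curve U x ->
  forall t : C, U t -> forall k,
  is_derive t (1 : C) (fun u => x u k) (meval (x t) (flow_coef k)).
Proof.
move=> oU [a0 [a1 [a2 [a3 [a4 [suma]]]]]].
move=> [q1 [p1 [q2 [p2 [q3 [p3 [q4 [p4 [sol xE]]]]]]]]] t Ut k.
have near_x (f : C -> C) d : (forall u, U u -> x u k = f u) ->
    is_derive t (1 : C) f d -> is_derive t (1 : C) (fun u => x u k) d.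
  move=> xf; apply: near_eq_is_derive.
  have : \forall u \near t, U u by apply: open_nbhs_nbhs.
  by apply: filterS => u Uu; rewrite xf.
have xt i : (i < 13)%N -> x t (inord i) = nth 0 [:: q1 t; p1 t; q2 t; p2 t; q3 t;
    p3 t; q4 t; p4 t; t; a1; a2; a3; a4] i.
  by move=> lti; rewrite xE // inordK.
have [[dq1 dp1] [[dq2 dp2] [[dq3 dp3] [dq4 dp4]]]] := sol t Ut.
have a0E : a0 = 1 - a1 - a2 - a3 - a4 by rewrite -suma; exact: complement_sum.
rewrite meval_flow_coef map_meval_star !xt //=.
case: k near_x => -[|[|[|[|[|[|[|[|[|[|[|[|[|]]]]]]]]]]]]] // lt_k near_x;
  rewrite ?[bump _ _]/=.
- exact: near_x (fun u Uu => xE u Uu _) dq1.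
- by apply: near_x (fun u Uu => xE u Uu _) _; rewrite /= -a0E.
- exact: near_x (fun u Uu => xE u Uu _) dq2.
- exact: near_x (fun u Uu => xE u Uu _) dp2.
- exact: near_x (fun u Uu => xE u Uu _) dq3.
- exact: near_x (fun u Uu => xE u Uu _) dp3.
- exact: near_x (fun u Uu => xE u Uu _) dq4.
- exact: near_x (fun u Uu => xE u Uu _) dp4.
- exact: near_x (fun u Uu => xE u Uu _) (is_derive_id _ _).
- exact: near_x (fun u Uu => xE u Uu _) (is_derive_cst _ _ _).
- exact: near_x (fun u Uu => xE u Uu _) (is_derive_cst _ _ _).
- exact: near_x (fun u Uu => xE u Uu _) (is_derive_cst _ _ _).
- exact: near_x (fun u Uu => xE u Uu _) (is_derive_cst _ _ _).
Qed.

Lemma solution_curve_time U x : solution_curve U x ->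
  forall t : C, U t -> x t (inord 8) = t.
Proof.
move=> [a0 [a1 [a2 [a3 [a4 [_]]]]]].
move=> [q1 [p1 [q2 [p2 [q3 [p3 [q4 [p4 [_ xE]]]]]]]]] t Ut.
by rewrite xE // inordK.
Qed.

Lemma solution_curve_param U x : solution_curve U x ->
  exists a : 'I_13 -> C, forall t : C, U t ->
    forall k : 'I_13, (8 < k)%N -> x t k = a k.
Proof.
move=> [a0 [a1 [a2 [a3 [a4 [_]]]]]].
move=> [q1 [p1 [q2 [p2 [q3 [p3 [q4 [p4 [_ xE]]]]]]]]].
exists (nth 0 [:: 0; 0; 0; 0; 0; 0; 0; 0; 0; a1; a2; a3; a4]) => t Ut k.
by rewrite xE //; case: k => -[|[|[|[|[|[|[|[|[|]]]]]]]]].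
Qed.

Lemma is_derive_meval x t :
  (forall k,
     is_derive t (1 : C) (fun u => x u k) (meval (x t) (flow_coef k))) ->
  forall p : A,
    is_derive t (1 : C) (fun u => meval (x u) p) (meval (x t) (flow p)).
Proof.
move=> dx; elim/mpoly_ring_ind=> [c|k|p q dp dq|p q dp dq].
- rewrite /flow field_derivC meval0.
  by under eq_fun do rewrite mevalC; apply: is_derive_cst.
- rewrite /flow field_derivX.
  by under eq_fun do rewrite mevalXU.
- rewrite /flow field_derivD mevalD.
  have -> : (fun u => meval (x u) (p + q)) =
      (fun u => meval (x u) p + meval (x u) q).
    by apply: funext => u; rewrite mevalD.
  exact: (is_derive_add dp dq).
- rewrite /flow field_derivM mevalD !mevalM.
  have -> : (fun u => meval (x u) (p * q)) =
      (fun u => meval (x u) p * meval (x u) q).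
    by apply: funext => u; rewrite mevalM.
  exact: (is_derive_mul dp dq).
Qed.

Lemma flow_frac (v : 'I_13 -> C) n d f g : is_der flow f g ->
  f = tofrac n / tofrac d -> meval v d != 0 ->
  value (meval v) g
    ((meval v (flow n) * meval v d - meval v n * meval v (flow d))
       / meval v d ^+ 2).
Proof.
move=> fg fE d0.
have dn0 : d != 0 by apply: contraNneq d0 => ->; rewrite meval0.
have -> : g = tofrac (flow n * d - n * flow d) / tofrac d ^+ 2.
  by apply: (is_der_unique _ fg); [exact: field_derivM | exists n, d].
rewrite -tofracXn; exists (flow n * d - n * flow d), (d ^+ 2).
by rewrite !rmorphXn !rmorphB !rmorphM expf_neq0.
Qed.

Lemma solution_curve_intro U y (c : 'I_13 -> C) :
  (forall t : C, U t -> y t (inord 8) = t) ->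
  (forall t : C, U t -> forall k : 'I_13, (8 < k)%N -> y t k = c k) ->
  (forall t : C, U t -> forall k,
     is_derive t (1 : C) (fun u => y u k) (meval (y t) (flow_coef k))) ->
  solution_curve U y.
Proof.
move=> y_time y_param y_flow.
pose a k := c (inord k).
exists (1 - a 9%N - a 10%N - a 11%N - a 12%N).
exists (a 9%N), (a 10%N), (a 11%N), (a 12%N).
split; first exact: sum_complement.
pose z k t := y t (inord k).
exists (z 0%N), (z 1%N), (z 2%N), (z 3%N), (z 4%N), (z 5%N), (z 6%N), (z 7%N).
have yE t : U t -> y t =1 nth 0 [:: z 0%N t; z 1%N t; z 2%N t; z 3%N t;
    z 4%N t; z 5%N t; z 6%N t; z 7%N t; t; a 9%N; a 10%N; a 11%N; a 12%N].
  move=> Ut k; rewrite -{1}(inord_val k).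
  case: k => -[|[|[|[|[|[|[|[|[|[|[|[|[|]]]]]]]]]]]]] //= _;
    by rewrite ?y_time // y_param ?inordK.
split=> // t Ut.
have dz k : (k < 13)%N -> is_derive t (1 : C) (z k)
    (vector_field (map (meval (y t)) (star_poly R)))`_(bump 9 k).
  by move=> lek; have := y_flow t Ut (inord k); rewrite meval_flow_coef inordK.
rewrite map_meval_star !yE // !inordK // in dz.
have := (dz 0 isT, dz 1 isT, dz 2 isT, dz 3 isT)%N.
have := (dz 4 isT, dz 5 isT, dz 6 isT, dz 7 isT)%N.
by move=> [[[? ?] ?] ?] [[[? ?] ?] ?].
Qed.

Section Commuting.
Variable s : {rmorphism F -> F}.
Hypothesis s_cst : forall c, s (cst c) = cst c.
Hypothesis s_time : s (coord R (inord 8)) = coord R (inord 8).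
Hypothesis s_flow :
  forall k, is_der flow (s (coord R k)) (s (tofrac (flow_coef k))).
Hypothesis s_param : forall k : 'I_13, (8 < k)%N -> exists2 p : A,
  s (coord R k) = tofrac p &
  forall v w : 'I_13 -> C, (forall j : 'I_13, (8 < j)%N -> v j = w j) ->
    meval v p = meval w p.

(** On a curve the derivative of y_k is the value of delta (s coord_k), which
    commutation turns into s (delta coord_k), whose value is the right-hand side
    of the system at y. *)
Lemma backlund_of_commuting : backlund s.
Proof.
move=> U x y oU solx xy.
have dx := solution_curve_derive oU solx.
have xyP p t : U t -> value (meval (x t)) (s (tofrac p)) (meval (y t) p).
  move=> Ut; elim/mpoly_ring_ind: p => [c|k|p q vp vq|p q vp vq].
  - by rewrite s_cst mevalC -{2}(mevalC (x t) c); apply: value_tofrac.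
  - by rewrite mevalXU; apply: xy.
  - by rewrite mevalD !rmorphD; apply: (ratD (value_rational _)).
  - by rewrite mevalM !rmorphM; apply: (ratM (value_rational _)).
have [a xa] := solution_curve_param solx.
have [c yc] : exists c : 'I_13 -> C, forall t : C, U t ->
    forall k : 'I_13, (8 < k)%N -> y t k = c k.
  have pP (k : 'I_13) : exists p : A, (8 < k)%N -> s (coord R k) = tofrac p /\
      forall v w : 'I_13 -> C, (forall j : 'I_13, (8 < j)%N -> v j = w j) ->
        meval v p = meval w p.
    by have [/s_param[p]|] := ltnP 8 k; [exists p | exists 0].
  have [p {}pP] := choice pP.
  exists (fun k => meval a (p k)) => t Ut k ltk; have [sk pk] := pP k ltk.
  have /value_unique := xy t Ut k; rewrite sk => /(_ _ (value_tofrac _ _)) ->.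
  by apply: pk; apply: xa.
apply: (solution_curve_intro _ yc) => t Ut; last move=> k.
  rewrite -[RHS](solution_curve_time solx Ut).
  apply: value_unique (xy t Ut (inord 8)) _.
  by rewrite s_time -(mevalXU (x t)); apply: value_tofrac.
(* the fraction n/d depends on t, but by uniqueness of values it represents
   y_k on a whole neighbourhood of t *)
have [n [d [skE d0 ytk]]] := xy t Ut k.
have near_y : \forall u \near t, meval (x u) n / meval (x u) d = y u k.
  have nearU : \forall u \near t, U u by apply: open_nbhs_nbhs.
  have := is_derive_near_neq0 (is_derive_meval (dx t Ut) d) d0.
  apply: filterS2 nearU => u Uu du0.
  by apply: value_unique (xy u Uu k); exists n, d.
apply: near_eq_is_derive near_y _.
have -> := value_unique (xyP (flow_coef k) t Ut) (flow_frac (s_flow k) skE d0).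
exact: (is_derive_quotient d0 (is_derive_meval (dx t Ut) n)
                              (is_derive_meval (dx t Ut) d)).
Qed.

End Commuting.
End Backlund.

Section PreservesFlow.
Variable R : realType.
Local Notation C := (Cx R).
Local Notation A := (mpoly 13 C).
Local Notation F := (RatFun R).

Lemma is_der_flow : derivation_rel (is_der (@flow R)).
Proof. by apply: is_der_rel; [exact: field_derivD | exact: field_derivM]. Qed.

Lemma flows_star : flows (is_der (@flow R)) (star R).
Proof.
have flow_star : map (@flow R) (star_poly R) = vector_field (star_poly R).
  have flowX i : (i < 13)%N ->
      flow (pcoord R i) = (vector_field (star_poly R))`_(bump 9 i).
    by move=> lti; rewrite /flow field_derivX /flow_coef inordK.
  have flow1 : flow (1 : A) = 0 by rewrite -mpolyC1; apply: field_derivC.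
  have flowB p q : flow (p - q) = flow p - flow q :> A.
    by rewrite /flow field_derivD (deltaN (@field_derivD _ _ _)).
  by rewrite [map _ _]/= !flowB flow1 !flowX //= !subr0.
move=> k; rewrite star_frac -map_vector_field -flow_star !nth_map_add.
have [ltk|lek] := ltnP k (size (star_poly R)).
  by rewrite (nth_map 0) //; apply: is_der_tofrac; apply: field_derivM.
by rewrite !nth_default ?size_map //; apply: (der0 is_der_flow).
Qed.

Definition preserves_flow (s : F -> F) :=
  forall f g, is_der (@flow R) f g -> is_der (@flow R) (s f) (s g).

(** Both sides of the commutation relation obey the rules of calculus, so that it
    is enough to check it on the generic point. *)
Lemma preserves_flow_star (s : {rmorphism F -> F}) :
  (forall c, s (cst c) = cst c) -> flows (is_der (@flow R)) (map s (star R)) ->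
  preserves_flow s.
Proof.
move=> s_cst fl.
have derP := is_der_flow.
have sA (p : A) : is_der (@flow R) (s (tofrac p)) (s (tofrac (flow p))).
  elim/mpoly_ring_ind: p => [c|k|p q dp dq|p q dp dq].
  - rewrite /flow field_derivC tofrac0 rmorph0 s_cst -tofrac0.
    rewrite -(field_derivC (@flow_coef R) c).
    by apply: is_der_tofrac; apply: field_derivM.
  - have := fl (bump 9 k); rewrite -map_vector_field !nth_map_add star_bump.
    by rewrite star_frac -map_vector_field nth_map_add /flow field_derivX.
  - rewrite /flow field_derivD !tofracD !(rmorphD s).
    exact: (derD derP dp dq).
  - rewrite /flow field_derivM tofracD !tofracM (rmorphD s) !(rmorphM s).
    exact: (derM derP dp dq).
move=> f g [n [d [d0 -> ->]]].
have sd0 : s (tofrac d) != 0 by rewrite fmorph_eq0 tofrac_eq0.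
have := derM derP (sA n) (derV derP sd0 (sA d)).
rewrite quotient_rule // => dnd.
rewrite !fmorph_div (rmorphXn s) tofracD tofracN !tofracM.
by rewrite (rmorphB s) !(rmorphM s).
Qed.

End PreservesFlow.

(** * The action of the extended affine Weyl group *)

Lemma fifth_complement (K : numFieldType) :
  5^-1 = 1 - 5^-1 - 5^-1 - 5^-1 - 5^-1 :> K.
Proof. by field. Qed.

Section Generators.
Variable R : realType.
Local Notation C := (Cx R).
Local Notation A := (mpoly 13 C).
Local Notation F := (RatFun R).

Variables S0 S1 S2 P : {rmorphism F -> F}.
Hypotheses (S0_cst : forall c, S0 (cst c) = cst c)
  (S1_cst : forall c, S1 (cst c) = cst c)
  (S2_cst : forall c, S2 (cst c) = cst c)
  (P_cst : forall c, P (cst c) = cst c).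
Hypotheses (S0_star : map S0 (star R) = s0_map (star R))
  (S1_star : map S1 (star R) = s1_map (star R))
  (S2_star : map S2 (star R) = s2_map (star R))
  (P_star : map P (star R) = pi_map (star R)).

(** A composite of automorphisms, kept as a list so that its value on the generic
    point can be computed one factor at a time. *)
Definition act (l : seq {rmorphism F -> F}) (f : F) : F :=
  foldr (fun (s : {rmorphism F -> F}) v => s v) f l.

Lemma act_rmorphism l : exists m : {rmorphism F -> F}, m =1 act l /\
  forall x, map m x = foldr (fun s : {rmorphism F -> F} => map s) x l.
Proof.
elim: l => [|s l [m [mE map_m]]].
  by exists idfun; split=> // x; apply: map_id.
exists (s \o m); split=> [f|x] /=; first by rewrite mE.
by rewrite -map_m -map_comp.
Qed.

Lemma act_ext l l' : (forall c, act l (cst c) = act l' (cst c)) ->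
  foldr (fun s : {rmorphism F -> F} => map s) (star R) l =
    foldr (fun s : {rmorphism F -> F} => map s) (star R) l' ->
  act l =1 act l'.
Proof.
have [m [mE map_m]] := act_rmorphism l.
have [m' [mE' map_m']] := act_rmorphism l'.
rewrite -map_m -map_m' => cE starE f; rewrite -mE -mE'.
by apply: ratfun_ext starE f => c; rewrite mE mE'.
Qed.

Definition gen (i : 'I_5) : {rmorphism F -> F} :=
  match val i with
  | 0 => S0 | 1 => S1 | 2 => S2 | 3 => P \o S1 \o P | _ => P \o S0 \o P
  end.

Let starE := (S0_star, S1_star, S2_star, P_star).
Let mapE := (@map_s0 F F, @map_s1 F F, @map_s2 F F, @map_pi F F).
Let cstE := (S0_cst, S1_cst, S2_cst, P_cst).

Lemma S0K f : S0 (S0 f) = f.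
Proof.
apply: (@act_ext [:: S0; S0] [::] _ _ f) => [c|].
  by rewrite /= !cstE.
by cbn [foldr]; rewrite !(starE, mapE) s0_mapK // f0_star.
Qed.

Lemma S1K f : S1 (S1 f) = f.
Proof.
apply: (@act_ext [:: S1; S1] [::] _ _ f) => [c|].
  by rewrite /= !cstE.
by cbn [foldr]; rewrite !(starE, mapE) s1_mapK // f1_star.
Qed.

Lemma S2K f : S2 (S2 f) = f.
Proof.
apply: (@act_ext [:: S2; S2] [::] _ _ f) => [c|].
  by rewrite /= !cstE.
by cbn [foldr]; rewrite !(starE, mapE) s2_mapK // f2_star.
Qed.

Lemma PK f : P (P f) = f.
Proof.
apply: (@act_ext [:: P; P] [::] _ _ f) => [c|].
  by rewrite /= !cstE.
by cbn [foldr]; rewrite !(starE, mapE) pi_mapK.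
Qed.

Lemma PS2 f : P (S2 f) = S2 (P f).
Proof.
apply: (@act_ext [:: P; S2] [:: S2; P] _ _ f) => [c|].
  by rewrite /= !cstE.
by cbn [foldr]; rewrite !(starE, mapE) -pi_s2 pi_mapK.
Qed.

Lemma S2S0 f : S2 (S0 f) = S0 (S2 f).
Proof.
apply: (@act_ext [:: S2; S0] [:: S0; S2] _ _ f) => [c|].
  by rewrite /= !cstE.
by cbn [foldr]; rewrite !(starE, mapE) s0s2_comm ?f0_star ?f2_star.
Qed.

Lemma S0S3 f : P (S1 (P (S0 f))) = S0 (P (S1 (P f))).
Proof.
apply: (@act_ext [:: P; S1; P; S0] [:: S0; P; S1; P] _ _ f) => [c|].
  by rewrite /= !cstE.
by cbn [foldr]; rewrite !(starE, mapE).
Qed.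

Lemma S0S4 f : P (S0 (P (S0 f))) = S0 (P (S0 (P f))).
Proof.
apply: (@act_ext [:: P; S0; P; S0] [:: S0; P; S0; P] _ _ f) => [c|].
  by rewrite /= !cstE.
by cbn [foldr]; rewrite !(starE, mapE).
Qed.

Lemma S1S3 f : P (S1 (P (S1 f))) = S1 (P (S1 (P f))).
Proof.
apply: (@act_ext [:: P; S1; P; S1] [:: S1; P; S1; P] _ _ f) => [c|].
  by rewrite /= !cstE.
cbn [foldr]; rewrite !(starE, mapE).
by have := s1s3_comm (star R); rewrite /s3_map => ->.
Qed.

Lemma S1S2 f : S1 (S2 (S1 f)) = S2 (S1 (S2 f)).
Proof.
apply: (@act_ext [:: S1; S2; S1] [:: S2; S1; S2] _ _ f) => [c|].
  by rewrite /= !cstE.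
cbn [foldr]; rewrite !(starE, mapE).
apply: (s1s2_braid (f1_star R) (f2_star R)).
- by rewrite -S1_star -map_f2 fmorph_eq0 f2_star.
- by rewrite -S2_star -map_f1 fmorph_eq0 f1_star.
Qed.

Lemma S0S1 f : S1 (S0 (S1 (S0 f))) = S0 (S1 (S0 (S1 f))).
Proof.
apply: (@act_ext [:: S1; S0; S1; S0] [:: S0; S1; S0; S1] _ _ f) => [c|].
  by rewrite /= !cstE.
cbn [foldr]; rewrite !(starE, mapE); symmetry.
apply: (s0s1_braid (f0_star R) (f1_star R)).
- by rewrite -S1_star -map_f0 fmorph_eq0 f0_star.
- by rewrite -S0_star -map_f1 fmorph_eq0 f1_star.
- by rewrite -S1_star -map_s0 -S0_star -!map_f1 !fmorph_eq0 f1_star.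
- by rewrite -S0_star -map_s1 -S1_star -!map_f0 !fmorph_eq0 f0_star.
Qed.

Local Notation gen_act := (word_act (fun i => gen i : {additive F -> F})).

(** The relations above, read from left to right, reduce each of the words
    (s_i s_j)^m to the empty word. *)
Lemma braid_gen (i j : 'I_5) f :
  gen_act (flatten (nseq (D52_mx i j) [:: i; j])) f = f.
Proof.
have S0S3' v : S1 (P (S0 v)) = P (S0 (P (S1 (P v)))).
  by rewrite -[LHS]PK S0S3.
have relE :=
  (S0K, S1K, S2K, PK, PS2, S2S0, S0S3, S0S4, S1S3, S0S3', S1S2, S0S1).
case: i j => [] [|[|[|[|[|//]]]]] ? [] [|[|[|[|[|//]]]]] ?.
all: by rewrite /D52_mx /word_act /gen /= !relE.
Qed.

Lemma P_gen i f : P (gen i f) = gen (rev_ord i) (P f).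
Proof.
by case: i => [] [|[|[|[|[|//]]]]] lti; rewrite /gen /= ?PK ?PS2.
Qed.

Definition alpha (i : 'I_5) : F := (star R)`_(9 + i).

(** The Cartan matrix off the diagonal, with the sign changed so that its entries
    are natural numbers. *)
Definition cartan (i j : 'I_5) : nat :=
  nth 0 (nth [::] [:: [:: 0; 2; 0; 0; 0];
                      [:: 1; 0; 1; 0; 0];
                      [:: 0; 1; 0; 1; 0];
                      [:: 0; 0; 1; 0; 1];
                      [:: 0; 0; 0; 2; 0]] i) j.

Lemma gen_star i : map (gen i) (star R) =
  nth (@s0_map F) [:: @s0_map F; @s1_map F; @s2_map F; @s3_map F; @s4_map F] i
    (star R).
Proof.
case: i => [] [|[|[|[|[|//]]]]] lti.
- exact: S0_star.
- exact: S1_star.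
- exact: S2_star.
- transitivity (map P (map S1 (map P (star R)))); first by rewrite -!map_comp.
  by rewrite !(starE, mapE).
- transitivity (map P (map S0 (map P (star R)))); first by rewrite -!map_comp.
  by rewrite !(starE, mapE).
Qed.

Lemma gen_alpha i : gen i (alpha i) = - alpha i.
Proof.
rewrite /alpha -nth_map_add gen_star.
by case: i => [] [|[|[|[|[|//]]]]] lti.
Qed.

Lemma gen_alpha_neq i j :
  i != j -> gen i (alpha j) = alpha j + alpha i *+ cartan i j.
Proof.
rewrite /alpha -nth_map_add gen_star.
case: i j => [] [|[|[|[|[|//]]]]] lti [] [|[|[|[|[|//]]]]] ltj //= _.
all: by rewrite ?mulr0n ?addr0 ?mulr1n ?mulr_natl.
Qed.

Lemma P_alpha i : P (alpha i) = alpha (rev_ord i).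
Proof.
rewrite /alpha -nth_map_add P_star.
by case: i => [] [|[|[|[|[|//]]]]] lti.
Qed.

(** For [k = 1, 2, 3] the image is computed from the entries (i, j) and (j, i) of
    [cartan], whose product 0, 1 or 2 determines the order 2, 3 or 4 of the
    product of the two reflections. *)
Lemma dihedral_gen k i j : i != j -> (0 < k < D52_mx i j)%N ->
  exists a b, (0 < a + b)%N /\
    gen_act (alt_word k i j) (alpha i) = alpha i *+ a + alpha j *+ b.
Proof.
move=> ij /andP[k_gt0 ltk].
have ji : j != i by rewrite eq_sym.
have E1 : gen j (alpha i) = alpha i + alpha j *+ cartan j i.
  exact: gen_alpha_neq.
have E2 : (0 < cartan i j * cartan j i)%N -> gen i (gen j (alpha i)) =
    alpha i *+ (cartan i j * cartan j i).-1 + alpha j *+ cartan j i.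
  move=> c_gt0; rewrite E1 raddfD raddfMn /= gen_alpha gen_alpha_neq //.
  rewrite mulrnDl -mulrnA -{1}(prednK c_gt0) mulrS addrCA addKr.
  by rewrite addrC.
have mE : D52_mx i j = nth 0 [:: 2; 3; 4] (cartan i j * cartan j i).
  by move: ij; case: i j {ji E1 E2 ltk}
    => [] [|[|[|[|[|//]]]]] lti [] [|[|[|[|[|//]]]]] ltj.
move: ltk; rewrite mE {mE}; move: E2.
set c := (cartan i j * cartan j i)%N => E2 ltk.
case: k k_gt0 ltk => [|[|[|k]]] // _ ltk.
- by exists 1%N, (cartan j i); rewrite /= E1 mulr1n.
- have c_gt0 : (0 < c)%N by case: c ltk {E2}.
  exists c.-1, (cartan j i); split; last exact: E2.
  by rewrite addn_gt0 orbC; move: c_gt0; rewrite /c muln_gt0 => /andP[_ ->].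
- have c2 : c = 2%N by case: c ltk {E2} => [|[|[|[|c]]]].
  have k0 : k = 0%N by move: ltk; rewrite c2; case: k.
  exists 1%N, 0%N; split=> //; rewrite k0 /= E2 c2 //= mulr1n raddfD raddfMn /=.
  by rewrite gen_alpha E1 mulNrn addrK mulr0n addr0.
Qed.

(** All five parameters have the value 1/5 there: a point inside the fundamental
    alcove. *)
Definition alcove_point : 'I_13 -> C := fun=> 5^-1.

Definition pos (f : F) := exists2 c, value (meval alcove_point) f c & 0 < c.

Lemma pos_alpha i : pos (alpha i).
Proof.
have c_gt0 : 0 < (5^-1 : C) by rewrite invr_gt0 ltr0n.
exists 5^-1 => //; rewrite /alpha star_frac nth_map_add.
have -> : 5^-1 = meval alcove_point (star_poly R)`_(9 + i).
  rewrite -nth_map_add map_meval_star /alcove_point.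
  case: i => [] [|[|[|[|[|//]]]]] lti //=.
  exact: fifth_complement.
exact: value_tofrac.
Qed.

Lemma posD f g : pos f -> pos g -> pos (f + g).
Proof.
move=> [c fc c0] [d gd d0]; exists (c + d); last exact: addr_gt0.
exact: (ratD (value_rational _)).
Qed.

Lemma pos_opp f : pos f -> ~ pos (- f).
Proof.
move=> [c fc c0] [d gd d0].
have := value_unique gd (ratN (value_rational _) fc) => dE.
by have := addr_gt0 c0 d0; rewrite dE subrr ltxx.
Qed.

Lemma gen_faithful u :
  (forall i, pos (gen_act u (alpha i))) -> coxeter_rel D52_mx u [::].
Proof.
apply: (coxeter_faithful D52_mx_diag _ braid_gen gen_alpha dihedral_gen
          posD pos_alpha pos_opp).
by move=> [] [|[|[|[|[|//]]]]] ? [] [|[|[|[|[|//]]]]] ?.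
Qed.

Lemma gen_cst i c : gen i (cst c) = cst c.
Proof. by case: i => [] [|[|[|[|[|//]]]]] lti; rewrite /gen /= !cstE. Qed.

Lemma gen_time i : gen i (coord R (inord 8)) = coord R (inord 8).
Proof.
have -> : coord R (inord 8) = (star R)`_8 by [].
rewrite -nth_map_add gen_star.
by case: i => [] [|[|[|[|[|//]]]]] lti.
Qed.

Lemma P_time : P (coord R (inord 8)) = coord R (inord 8).
Proof.
have -> : coord R (inord 8) = (star R)`_8 by [].
by rewrite -nth_map_add P_star.
Qed.

Lemma P_preserves_flow : preserves_flow P.
Proof.
apply: (preserves_flow_star P_cst); rewrite P_star.
exact: (pi_flows (@is_der_flow R) (@flows_star R)).
Qed.

Lemma gen_preserves_flow i : preserves_flow (gen i).
Proof.
have fl := (@flows_star R).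
have fl0 : preserves_flow S0.
  apply: (preserves_flow_star S0_cst); rewrite S0_star.
  exact: (s0_flows (@is_der_flow R) (f0_star R) fl).
have fl1 : preserves_flow S1.
  apply: (preserves_flow_star S1_cst); rewrite S1_star.
  exact: (s1_flows (@is_der_flow R) (f1_star R) fl).
have fl2 : preserves_flow S2.
  apply: (preserves_flow_star S2_cst); rewrite S2_star.
  exact: (s2_flows (@is_der_flow R) (size_star R) (f2_star R) (sum_a_star R) fl).
have flP := P_preserves_flow.
by case: i => [] [|[|[|[|[|//]]]]] lti f g fg; rewrite /gen /=; auto.
Qed.

(** Stable under the generators, and constant along each solution: this is why
    the parameters of the image of a solution are constants. *)
Inductive root_lattice : F -> Prop :=
| RootLattice0 : root_lattice 0
| RootLatticeRoot i : root_lattice (alpha i)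
| RootLatticeD f g : root_lattice f -> root_lattice g -> root_lattice (f + g)
| RootLatticeN f : root_lattice f -> root_lattice (- f).

Lemma root_latticeMn f n : root_lattice f -> root_lattice (f *+ n).
Proof.
move=> lf; elim: n => [|n IHn]; first exact: RootLattice0.
by rewrite mulrS; apply: RootLatticeD.
Qed.

Lemma gen_root_lattice i f : root_lattice f -> root_lattice (gen i f).
Proof.
elim=> {f} [|j|f g _ lf _ lg|f _ lf].
- by rewrite raddf0; apply: RootLattice0.
- have [<-|ij] := eqVneq i j.
    by rewrite gen_alpha; apply/RootLatticeN/RootLatticeRoot.
  rewrite gen_alpha_neq //; apply/RootLatticeD/root_latticeMn/RootLatticeRoot.
  exact: RootLatticeRoot.
- by rewrite raddfD; apply: RootLatticeD.
- by rewrite raddfN; apply: RootLatticeN.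
Qed.

Lemma P_root_lattice f : root_lattice f -> root_lattice (P f).
Proof.
elim=> {f} [|j|f g _ lf _ lg|f _ lf].
- by rewrite raddf0; apply: RootLattice0.
- by rewrite P_alpha; apply: RootLatticeRoot.
- by rewrite raddfD; apply: RootLatticeD.
- by rewrite raddfN; apply: RootLatticeN.
Qed.

Lemma root_lattice_param f : root_lattice f -> exists2 p : A,
  f = tofrac p &
  forall v w : 'I_13 -> C, (forall j : 'I_13, (8 < j)%N -> v j = w j) ->
    meval v p = meval w p.
Proof.
elim=> {f} [|i|f g _ [p -> pP] _ [q -> qP]|f _ [p -> pP]].
- by exists 0 => [|v w _]; rewrite ?tofrac0 ?meval0.
- exists (star_poly R)`_(9 + i) => [|v w vw].
    by rewrite /alpha star_frac nth_map_add.
  rewrite -!nth_map_add !map_meval_star.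
  by case: i => [] [|[|[|[|[|//]]]]] lti /=; rewrite !vw ?inordK.
- exists (p + q) => [|v w vw]; first by rewrite tofracD.
  by rewrite !mevalD (pP _ _ vw) (qP _ _ vw).
- exists (- p) => [|v w vw]; first by rewrite tofracN.
  by rewrite !mevalN (pP _ _ vw).
Qed.

(** Sufficient properties for a Baecklund transformation which, being free of
    points where values are undefined, are stable under composition. *)
Definition is_symmetry (s : F -> F) :=
  [/\ forall c, s (cst c) = cst c, s (coord R (inord 8)) = coord R (inord 8),
     preserves_flow s & forall f, root_lattice f -> root_lattice (s f)].

Lemma is_symmetry_comp s s' :
  is_symmetry s -> is_symmetry s' -> is_symmetry (s \o s').
Proof.
move=> [sC st sd sL] [s'C s't s'd s'L].
split=> [c||f g /s'd/sd //|f /s'L/sL //] /=.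
  by rewrite s'C.
by rewrite s't.
Qed.

Lemma backlund_of_symmetry (s : {rmorphism F -> F}) : is_symmetry s -> backlund s.
Proof.
move=> [s_cst s_time s_flow s_lat]; apply: backlund_of_commuting => // k.
  apply: s_flow; rewrite -[coord R k]/(tofrac (mpolyX C (mnm1 k))).
  rewrite -(field_derivX (@flow_coef R)).
  by apply: is_der_tofrac; exact: field_derivM.
move=> ltk; apply/root_lattice_param/s_lat.
have lt5 : (k - 8 < 5)%N by rewrite ltn_subLR // ltnW.
have -> : coord R k = alpha (Ordinal lt5); last exact: RootLatticeRoot.
rewrite /alpha -star_bump; congr (_`__).
by rewrite /bump ltk -[9%N]/(1 + 8)%N -addnA subnKC // ltnW.
Qed.

Lemma word_rmorphism u b : exists m : {rmorphism F -> F},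
  m =1 fun f => gen_act u (if b then P f else f).
Proof.
elim: u => [|i u [m mE]]; first by case: b; [exists P | exists idfun].
by exists (gen i \o m) => f /=; rewrite mE.
Qed.

Lemma P_gen_act u f : P (gen_act u f) = gen_act (map (@rev_ord 5) u) (P f).
Proof. by elim: u => //= i u IHu; rewrite P_gen IHu. Qed.

Lemma is_symmetry_gen i : is_symmetry (gen i).
Proof.
split; [exact: gen_cst | exact: gen_time | exact: gen_preserves_flow
  | exact: gen_root_lattice].
Qed.

Lemma is_symmetry_P : is_symmetry P.
Proof.
split; [exact: P_cst | exact: P_time | exact: P_preserves_flow
  | exact: P_root_lattice].
Qed.

Lemma is_symmetry_word u b :
  is_symmetry (fun f => gen_act u (if b then P f else f)).
Proof.
elim: u => [|i u IHu]; last exact: is_symmetry_comp (is_symmetry_gen i) IHu.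
by case: b; [exact: is_symmetry_P | split].
Qed.

Definition weyl_action (g : ext_weylD52) : {rmorphism F -> F} :=
  projT1 (cid (word_rmorphism (repr g.1) g.2)).

Lemma weyl_actionE g f :
  weyl_action g f = gen_act (repr g.1) (if g.2 then P f else f).
Proof. exact: projT2 (cid (word_rmorphism (repr g.1) g.2)) f. Qed.

Lemma gen_act_rel u v f : coxeter_rel D52_mx u v -> gen_act u f = gen_act v f.
Proof. exact: (word_act_rel braid_gen). Qed.

Lemma gen_act_repr u f : gen_act (repr (weyl_word u)) f = gen_act u f.
Proof. exact/gen_act_rel/weyl_word_repr. Qed.

Lemma weyl_action_cst g c : weyl_action g (cst c) = cst c.
Proof.
by rewrite weyl_actionE; have [actC _ _ _] := is_symmetry_word (repr g.1) g.2.
Qed.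

Lemma weyl_actionM g h :
  weyl_action (g * h)%g =1 weyl_action g \o weyl_action h.
Proof.
move=> f /=; rewrite !weyl_actionE; case: g h => [g a] [h b] /=.
rewrite -[(g * _)%g]/(weylD52_mul g _) gen_act_repr word_act_cat.
congr (gen_act _ _).
case: a => //=; rewrite /weylD52_diag gen_act_repr P_gen_act.
by case: b; rewrite ?PK.
Qed.

Lemma weyl_action1 : weyl_action 1%g =1 id.
Proof.
by move=> f; rewrite weyl_actionE /= -[1%g]/(weyl_word [::]) gen_act_repr.
Qed.

(** An element acting trivially sends every simple root to a simple root, up to
    pi, so its component in the Weyl group is trivial; and pi itself moves q_1. *)
Lemma weyl_action_faithful g : weyl_action g =1 id -> g = 1%g.
Proof.
case: g => g b act_g0.
have act_g f : gen_act (repr g) (if b then P f else f) = f.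
  by rewrite -[RHS]act_g0 weyl_actionE.
have g1 : coxeter_rel D52_mx (repr g) [::].
  apply: gen_faithful => i; case: b act_g {act_g0} => act_g; last first.
    by rewrite act_g; apply: pos_alpha.
  by rewrite -(rev_ordK i) -P_alpha act_g; apply: pos_alpha.
have -> : g = 1%g by rewrite -[g]weyl_wordK; apply/weyl_wordP.
case: b act_g {act_g0} => // act_g; have := act_g (coord R (inord 0)).
rewrite (gen_act_rel _ g1) /=.
have -> : P (coord R (inord 0)) = coord R (inord 6).
  have -> : coord R (inord 0) = (star R)`_0 by [].
  by rewrite -nth_map_add P_star.
pose v (k : 'I_13) : C := (k == 0%N :> nat)%:R.
move/eqP; rewrite tofrac_eq => /eqP /(congr1 (meval v)).
by rewrite !mevalXU /v !inordK //= => /eqP; rewrite eq_sym oner_eq0.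
Qed.

Lemma weyl_action_backlund g : backlund (weyl_action g).
Proof.
apply: backlund_of_symmetry.
have -> : weyl_action g =
    (fun f => gen_act (repr g.1) (if g.2 then P f else f)) :> (F -> F).
  by apply: funext => f; apply: weyl_actionE.
exact: is_symmetry_word.
Qed.

Lemma weyl_action_s k :
  map (weyl_action (weyl_s k)) (star R) = map (gen (inord k)) (star R).
Proof. by apply: eq_map => f; rewrite weyl_actionE /= gen_act_repr. Qed.

Lemma weyl_action_pi : map (weyl_action weyl_pi) (star R) = map P (star R).
Proof.
apply: eq_map => f.
by rewrite weyl_actionE /= -[1%g]/(weyl_word [::]) gen_act_repr.
Qed.

End Generators.

Theorem theorem3p1 (R : realType) :
  exists Phi : ext_weylD52 -> {rmorphism RatFun R -> RatFun R},
    [/\ forall g (c : Cx R), Phi g (cst c) = cst c,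
        Phi 1%g =1 id,
        forall g h, Phi (g * h)%g =1 Phi g \o Phi h
      & forall g, Phi g =1 id -> g = 1%g] /\
    [/\ map (Phi (weyl_s 0)) (star R) = s0_star R,
        map (Phi (weyl_s 1)) (star R) = s1_star R,
        map (Phi (weyl_s 2)) (star R) = s2_star R,
        map (Phi (weyl_s 3)) (star R) = s3_star R
      & map (Phi (weyl_s 4)) (star R) = s4_star R] /\
    map (Phi weyl_pi) (star R) = pi_star R /\
    forall g, backlund (Phi g).
Proof.
have [S0 [S0_cst S0_star]] := exists_s0 R.
have [S1 [S1_cst S1_star]] := exists_s1 R.
have [S2 [S2_cst S2_star]] := exists_s2 R.
have [P [P_cst P_star]] := exists_pi R.
exists (weyl_action S0 S1 S2 P); split; last split; last split.
- split; [exact: weyl_action_cst | exact: weyl_action1 | exact: weyl_actionM |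
    exact: weyl_action_faithful].
- have sE k : (k < 5)%N -> map (weyl_action S0 S1 S2 P (weyl_s k)) (star R) =
      nth (@s0_map (RatFun R)) [:: @s0_map (RatFun R); @s1_map (RatFun R);
        @s2_map (RatFun R); @s3_map (RatFun R); @s4_map (RatFun R)] k (star R).
    by move=> ltk; rewrite weyl_action_s // gen_star // inordK.
  by split; rewrite sE.
- by rewrite weyl_action_pi // P_star.
- exact: weyl_action_backlund.
Qed.
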